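(* Let $M\subset\mathbb{R}^{2n}$ be a real analytic hypersurface with $0\in M$ and let $J$ be a real analytic almost complex structure on $\mathbb{R}^{2n}$. Let $X\in T^JM$ be a real analytic vector field in a neighborhood of $0\in M$ such that $\mathbb{L}(X)$ is included in $T^JM$. Then, for all $p\in M$ in a neighborhood of $0$, there exists a germ of $J$-holomorphic disc $\gamma$ such that (1) $\gamma(0)=p$; (2) for all integers $k\ge1$, $\frac{\partial^k\gamma}{\partial x^k}(0)=D_X^{k-1,0}X(p)$.
   Context: A real analytic hypersurface is $M=\{\varphi=0\}$ with $\varphi$ real valued, real analytic, and $d\varphi$ nowhere vanishing on $M$. An almost complex structure is a field $J$ of endomorphisms of the tangent spaces with $J^2=-\mathrm{Id}$; without restriction $J(0)=J_0$, the standard complex structure of $\mathbb{R}^{2n}=\mathbb{C}^n$, and $J$ is as close to $J_0$ as needed. $T^JM=TM\cap J\,TM$ is the $J$-invariant part of the tangent bundle $TM$; ''$X\in T^JM$'' means that $X(z)\in T^J_zM$ for $z\in M$. $\mathbb{L}(X)$ is the complex Lie algebra generated by $X$: the smallest complex (i.e. $J$-stable) Lie algebra of vector fields which contains $X$ and $JX$ and is such that $[Y,Z]\in\mathbb{L}(X)$ whenever $Y,Z\in\mathbb{L}(X)$. A symmetric connection $\nabla$ is fixed; $X\cdot Y$ denotes $\nabla_XY$, and $D_X^{k,0}Y=X\cdot(X\cdots(X\cdot Y)\cdots)$ with $k$ occurrences of $X$. A $J$-holomorphic disc is a $C^1$ map $\gamma$ from the unit disc of $\mathbb{C}$ to $\mathbb{R}^{2n}$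 with $d\gamma(\zeta)\circ J_0=J(\gamma(\zeta))\circ d\gamma(\zeta)$ for all $\zeta=x+iy$ ($J_0$ being here the standard structure of $\mathbb{C}$); a germ of $J$-holomorphic disc is such a map defined on some disc $\{|\zeta|<\varepsilon\}$, $\varepsilon>0$. *)

(* Defs.v *)
From HB Require Import structures.
From mathcomp Require Import all_boot all_order all_algebra.
From mathcomp Require Import all_classical all_reals all_analysis.
Set Implicit Arguments.
Unset Strict Implicit.
Unset Printing Implicit Defensive.
Import Order.TTheory GRing.Theory Num.Theory.
Import numFieldNormedType.Exports.
Local Open Scope classical_set_scope.
Local Open Scope ring_scope.

(* Points and tangent vectors of R^m are row vectors, so an endomorphism [A]
   acts by [v |-> v *m A].  Objects living on an open set [U] are total
   functions of which only the values on [U] matter. *)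

Section Analytic.
Context {R : realType} {m : nat}.

Definition monomial (al : {ffun 'I_m -> nat}) (h : 'rV[R]_m) : R :=
  \prod_i h 0 i ^+ al i.

(* The box partial sums below exhaust all multi-indices; as the family is
   absolutely summable, their limit is its unordered sum. *)
Definition real_analytic (U : set 'rV[R]_m) (f : 'rV[R]_m -> R) : Prop :=
  forall a, U a ->
  exists (c : {ffun 'I_m -> nat} -> R) (r : R), 0 < r /\
    forall h : 'rV[R]_m, `|h| < r ->
      summable setT (fun al => (c al * monomial al h)%:E) /\
      (fun N : nat => \sum_(be : {ffun 'I_m -> 'I_N})
          let al := [ffun i => nat_of_ord (be i)] in
          c al * monomial al h) @ \oo --> f (a + h).

Definition real_analytic_field (U : set 'rV[R]_m) (X : 'rV[R]_m -> 'rV[R]_m) :=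
  forall i, real_analytic U (fun z => X z 0 i).

End Analytic.

Fixpoint class_C {R : realType} {V W : normedModType R} (k : nat)
    (f : V -> W) : Prop :=
  if k is k'.+1 then
    (forall z, differentiable f z) /\ forall v, class_C k' (fun z => 'D_v f z)
  else continuous f.

Definition smooth {R : realType} {V W : normedModType R} (f : V -> W) : Prop :=
  forall k, class_C k f.

Section Geometry.
Context {R : realType} {n : nat}.
Let E : Type := 'rV[R]_(n + n).

(* R^{2n} = C^n through (x, y) <-> x + i y, so that J_0 (x, y) = (- y, x). *)
Definition J0 : 'M[R]_(n + n) := block_mx 0 1%:M (- 1%:M) 0.

Definition almost_complex (J : E -> 'M[R]_(n + n)) : Prop :=
  forall z, J z *m J z = - 1%:M.

Definition real_analytic_structure (J : E -> 'M[R]_(n + n)) : Prop :=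
  forall i j, real_analytic setT (fun z => J z i j).

Definition real_analytic_hypersurface (phi : E -> R) : Prop :=
  real_analytic setT phi /\
  forall z, phi z = 0 -> exists v : E, 'd phi z v != 0.

Definition hypersurface (phi : E -> R) : set E := [set z | phi z = 0].

Definition tangent (phi : E -> R) (z : E) : set E := [set v | 'd phi z v = 0].

Definition J_tangent (J : E -> 'M[R]_(n + n)) (phi : E -> R) (z : E) : set E :=
  tangent phi z `&` [set v *m J z | v in tangent phi z].

Definition in_J_tangent (J : E -> 'M[R]_(n + n)) (phi : E -> R) (U : set E)
    (X : E -> E) : Prop :=
  forall z, U z -> hypersurface phi z -> J_tangent J phi z (X z).

Definition Jfield (J : E -> 'M[R]_(n + n)) (X : E -> E) : E -> E :=
  fun z => X z *m J z.

Definition bracket (X Y : E -> E) : E -> E :=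
  fun z => 'D_(X z) Y z - 'D_(Y z) X z.

Record complex_Lie_algebra (J : E -> 'M[R]_(n + n)) (U : set E)
    (L : set (E -> E)) : Prop := {
  cla_field : forall Y, L Y -> real_analytic_field U Y;
  cla_zero : L (fun=> 0);
  cla_add : forall Y Z, L Y -> L Z -> L (fun z => Y z + Z z);
  cla_scale : forall (a : R) Y, L Y -> L (fun z => a *: Y z);
  cla_J : forall Y, L Y -> L (Jfield J Y);
  cla_bracket : forall Y Z, L Y -> L Z -> L (bracket Y Z) }.

Definition generated_Lie (J : E -> 'M[R]_(n + n)) (U : set E) (X : E -> E) :
    set (E -> E) :=
  smallest (complex_Lie_algebra J U) [set X; Jfield J X].

(* A connection on R^{2n} is given by its Christoffel symbols: [G k i j] is
   the k-th component of nabla_{e_i} e_j. *)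
Definition christoffel : Type :=
  'I_(n + n) -> 'I_(n + n) -> 'I_(n + n) -> E -> R.

Definition christoffel_form (G : christoffel) (z u v : E) : E :=
  \row_k \sum_i \sum_j G k i j z * u 0 i * v 0 j.

Definition nabla (G : christoffel) (X Y : E -> E) : E -> E :=
  fun z => 'D_(X z) Y z + christoffel_form G z (X z) (Y z).

Definition smooth_connection (G : christoffel) : Prop :=
  forall k i j, smooth (G k i j).

Definition real_analytic_connection (G : christoffel) : Prop :=
  forall k i j, real_analytic setT (G k i j).

Definition symmetric_connection (G : christoffel) : Prop :=
  forall X Y : E -> E, smooth X -> smooth Y ->
  forall z, nabla G X Y z - nabla G Y X z = bracket X Y z.

(* D_X^{k,0} Y *)
Definition iter_nabla (G : christoffel) (k : nat) (X Y : E -> E) : E -> E :=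
  iter k (nabla G X) Y.

Definition disc (eps : R) : set (R * R) :=
  [set z | z.1 ^+ 2 + z.2 ^+ 2 < eps ^+ 2].

(* C^1 on the disc, with d gamma o J_0 = J(gamma) o d gamma; on C = R^2 the
   standard structure is (a, b) |-> (- b, a). *)
Definition J_holomorphic (J : E -> 'M[R]_(n + n)) (eps : R)
    (gamma : R * R -> E) : Prop :=
  forall z, disc eps z ->
    [/\ differentiable gamma z,
        forall v : R * R, {for z, continuous (fun w => 'd gamma w v : E)} &
        forall v : R * R, 'd gamma z (- v.2, v.1) = 'd gamma z v *m J (gamma z)].

Definition partial_x (W : R * R -> E) : R * R -> E :=
  fun z => 'D_((1, 0) : R * R) W z.

(* Covariant x-derivative of a vector field [W] along the map [gamma]. *)
Definition cov_x (G : christoffel) (gamma W : R * R -> E) : R * R -> E :=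
  fun z => partial_x W z + christoffel_form G (gamma z) (partial_x gamma z) (W z).

(* k-th x-derivative of [gamma] (k >= 1) in coordinates, resp. for the
   connection; in the second case the first derivative is the vector field
   d gamma / dx along [gamma], which is then differentiated covariantly. *)
Definition xder (k : nat) (gamma : R * R -> E) : R * R -> E :=
  iter k partial_x gamma.

Definition cov_xder (G : christoffel) (k : nat) (gamma : R * R -> E) :
    R * R -> E :=
  iter k.-1 (cov_x G gamma) (partial_x gamma).

Definition x_derivable (eps : R) (W : R * R -> E) : Prop :=
  forall z, disc eps z -> derivable W z ((1, 0) : R * R).

End Geometry.

(* Main.v *)
Require Import Defs.
From HB Require Import structures.
From mathcomp Require Import all_boot all_order all_algebra.
From mathcomp Require Import all_classical all_reals all_analysis.
From mathcomp Require Import ring lra.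
Set Implicit Arguments.
Unset Strict Implicit.
Unset Printing Implicit Defensive.
Import Order.TTheory GRing.Theory Num.Theory.
Import numFieldNormedType.Exports.
Local Open Scope classical_set_scope.
Local Open Scope ring_scope.

(** Neither conclusion forces the disc to lie in [M]: along [y = 0] the disc may
    be any real analytic curve through [p], because [d gamma / dy = d gamma / dx *m J gamma]
    with prescribed analytic values on [y = 0] is a Cauchy-Kowalevski problem.

    For the covariant derivatives take the integral curve [c] of [X], on which
    the [k]-th covariant derivative of [c'] is [D_X^{k,0} X].  For the coordinate
    derivatives take the development [d' = X(c) *m P] of [c], where [P] is the
    parallel transport [P' = connection_mx(c) *m P], [P(0) = 1]: by induction the
    [(k+1)]-st derivative of [d] is [D_X^{k,0} X (c) *m P].  The triple [(c, P, d)]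
    solves an analytic ODE, which is again a Cauchy-Kowalevski problem.

    Cauchy-Kowalevski itself is solved on coefficient arrays [u i j] with the
    norm [sum |u i j| r^i s^j / 'C(i + j, i)].  It is submultiplicative
    (Vandermonde), and integrating [d_x u * v] in [y] costs only the factor
    [s / r], so for small [s] the integral equation preserves a ball; its fixed
    point exists since the coefficients of [y^(j+1)] only involve those of lower
    order in [y]. *)

(** * Unordered sums *)

(** The obstacle is a loss of one derivative: integrating a product with [aDx u] in y produces
    factors (i + 1) / (j + 1), which are unbounded for the plain weight r^i s^j. Dividing this
    weight by the binomial coefficient cancels them exactly. The price is that evaluation is
    controlled only on the bidisc of half radii. The bounds for composition with an analytic
    function depend on the radius [eps] of the ball but not on r and s. Hence r can first be shrunk
    until the initial data are small, and then s until the integrated right side is small.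
    Invariance of the ball is the only estimate: convergence of the iteration is algebraic,
    coefficient by coefficient, so no contraction constant is sought. The two conclusions ask
    different things of the connection. The integral curve of [X] does not involve [G], so in the
    covariant reading [G] enters only through derivatives along a known curve, and smoothness
    suffices there. In the coordinate reading [G] is a coefficient of the equation for P, and the
    series method uses its analyticity. *)

Section UnorderedSum.
Context {R : realType}.

Definition asum {T : choiceType} (f : T -> R) : \bar R :=
  \esum_(t in [set: T]) `|f t|%:E.

Definition absum {T : choiceType} (f : T -> R) : Prop := (asum f < +oo)%E.

(* [f] is the difference of the nonnegative families [|f| + f] and [|f|]; the
   value is junk unless [absum f]. *)
Definition tsum {T : choiceType} (f : T -> R) : R :=
  fine (\esum_(t in [set: T]) (`|f t| + f t)%:E) - fine (asum f).

Section OneIndex.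
Context {T : choiceType}.
Implicit Types f g : T -> R.

Lemma asum_ge0 f : (0 <= asum f)%E.
Proof. by apply: esum_ge0 => t _; rewrite lee_fin. Qed.

Lemma le_asum f g : (forall t, `|f t| <= `|g t|) -> (asum f <= asum g)%E.
Proof. by move=> fg; apply: le_esum => t _; rewrite lee_fin. Qed.

Lemma le_absum f g : (forall t, `|f t| <= `|g t|) -> absum g -> absum f.
Proof. by move=> /le_asum; exact: le_lt_trans. Qed.

Lemma asum_absum f (M : R) : (asum f <= M%:E)%E -> absum f.
Proof. by move=> fM; rewrite /absum (le_lt_trans fM) ?ltry. Qed.

Lemma absumE f : absum f -> asum f = (fine (asum f))%:E.
Proof. by move=> sf; rewrite fineK// ge0_fin_numE// asum_ge0. Qed.

Lemma asum_fine_ge0 f : 0 <= fine (asum f).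
Proof. by rewrite fine_ge0// asum_ge0. Qed.

(** One inequality holds for every scalar and every family; applied to the inverse of a nonzero [a]
    it gives the reverse one. *)
Lemma asumZ (a : R) f : asum (fun t => a * f t) = (`|a|%:E * asum f)%E.
Proof.
have H (b : R) g : (asum (fun t => b * g t)%R <= `|b|%:E * asum g)%E.
  apply: ge_ereal_sup => _ [X [fX _] <-].
  rewrite fsbig_finite//=.
  under eq_bigr do rewrite normrM EFinM.
  rewrite -ge0_sume_distrr; last by move=> *; rewrite lee_fin.
  apply: lee_pmul => //; first by rewrite sume_ge0// => *; rewrite lee_fin.
  by apply: ereal_sup_ubound; exists X => //; rewrite fsbig_finite.
apply/eqP; rewrite eq_le H/=.
have [->|a0] := eqVneq a 0; first by rewrite normr0 mul0e asum_ge0.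
have := H a^-1 (fun t => a * f t).
rewrite (_ : (fun t => _) = f); last by apply/funext => t; rewrite mulKf.
move=> /(lee_pmul (x1 := `|a|%:E) (y1 := `|a|%:E)).
rewrite lee_fin normr_ge0 asum_ge0 lexx => /(_ isT isT isT) /le_trans; apply.
by rewrite muleA -EFinM -normrM mulfV// normr1 mul1e.
Qed.

Lemma absumZ (a : R) f : absum f -> absum (fun t => a * f t).
Proof.
by move=> sf; rewrite /absum asumZ lte_mul_pinfty.
Qed.

Lemma asumD f g : (asum (fun t => f t + g t)%R <= asum f + asum g)%E.
Proof.
rewrite /asum -esumD; do ?by move=> *; rewrite lee_fin.
by apply: le_esum => t _; rewrite -EFinD lee_fin ler_normD.
Qed.

Lemma absumD f g : absum f -> absum g -> absum (fun t => f t + g t).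
Proof. by move=> sf sg; apply: le_lt_trans (asumD f g) _; rewrite lte_add_pinfty. Qed.

Lemma absumN f : absum f -> absum (fun t => - f t).
Proof. by apply: le_absum => t; rewrite normrN. Qed.

Lemma absumB f g : absum f -> absum g -> absum (fun t => f t - g t).
Proof. by move=> sf sg; apply: absumD => //; exact: absumN. Qed.

(** The sum is a supremum over finite sets, and each of these sees only finitely many values. This
    is what keeps a coefficientwise limit of arrays in a ball inside that ball. *)
Lemma asum_approx f (M : R) :
  (forall X : seq T, exists2 g, (asum g <= M%:E)%E & {in X, f =1 g}) ->
  (asum f <= M%:E)%E.
Proof.
move=> H; apply: ge_ereal_sup => _ [X [fX _] <-].
have [g gM fg] := H (finmap.enum_fset (fset_set X)).
rewrite fsbig_finite//= big_seq.
under eq_bigr => t tX do rewrite fg//.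
rewrite -big_seq; apply: le_trans gM.
by apply: ereal_sup_ubound; exists X => //; rewrite fsbig_finite.
Qed.

Lemma fine_asumD f g : absum f -> absum g ->
  (forall t, 0 <= f t) -> (forall t, 0 <= g t) ->
  fine (asum (fun t => f t + g t)) = fine (asum f) + fine (asum g).
Proof.
move=> sf sg f0 g0; apply: EFin_inj; rewrite EFinD -!absumE//; last exact: absumD.
rewrite /asum -esumD; do ?by move=> *; rewrite lee_fin.
by apply: eq_esum => t _; rewrite -EFinD !ger0_norm// addr_ge0.
Qed.

Lemma asum_norm f : asum (fun t => `|f t|) = asum f.
Proof. by apply: eq_esum => t _; rewrite normr_id. Qed.

Lemma absum_norm f : absum f -> absum (fun t => `|f t|).
Proof. by rewrite /absum asum_norm. Qed.

Lemma norm_add_ge0 (x : R) : 0 <= `|x| + x.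
Proof. by have := ler_norm (- x); rewrite normrN; lra. Qed.

Lemma absum_pos f : absum f -> absum (fun t => `|f t| + f t).
Proof. by move=> sf; apply: absumD => //; exact: absum_norm. Qed.

Lemma tsumE f :
  tsum f = fine (asum (fun t => `|f t| + f t)) - fine (asum (fun t => `|f t|)).
Proof.
rewrite /tsum asum_norm; congr (fine _ - _).
by apply: eq_esum => t _; rewrite (ger0_norm (norm_add_ge0 _)).
Qed.

(** The value does not depend on how [f] is split into nonnegative summable parts, because [|f| + a]
    and [(|f| + f) + b] are the same family. Linearity of [tsum] follows by choosing convenient
    splittings. *)
Lemma tsum_diff (f a b : T -> R) : (forall t, f t = a t - b t) ->
  (forall t, 0 <= a t) -> (forall t, 0 <= b t) -> absum a -> absum b ->
  tsum f = fine (asum a) - fine (asum b).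
Proof.
move=> fE a0 b0 sa sb.
have sf : absum f.
  by rewrite (_ : f = fun t => a t - b t); [exact: absumB|exact/funext].
rewrite tsumE.
have := fine_asumD (absum_pos sf) sb (fun t => norm_add_ge0 _) b0.
have := fine_asumD (absum_norm sf) sa (fun t => normr_ge0 _) a0.
rewrite (_ : (fun t => `|f t| + a t) = (fun t => `|f t| + f t + b t)); last first.
  by apply/funext => t; rewrite fE; lra.
lra.
Qed.

Lemma fine_le_asum f g : absum g -> (forall t, `|f t| <= `|g t|) ->
  fine (asum f) <= fine (asum g).
Proof.
move=> sg fg; have sf := le_absum fg sg.
by rewrite -lee_fin -!absumE// le_asum.
Qed.

Lemma fine_asumZ (a : R) f : absum f ->
  fine (asum (fun t => a * f t)) = `|a| * fine (asum f).
Proof. by move=> sf; rewrite asumZ (absumE sf). Qed.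

Lemma tsum_norm f : absum f -> `|tsum f| <= fine (asum f).
Proof.
move=> sf; rewrite tsumE asum_norm ler_norml; apply/andP; split.
  by have := asum_fine_ge0 (fun t => `|f t| + f t); lra.
have : fine (asum (fun t => `|f t| + f t)) <= fine (asum (fun t => 2 * f t)).
  apply: fine_le_asum; first exact: absumZ.
  move=> t; rewrite (ger0_norm (norm_add_ge0 _)) normrM ger0_norm//.
  by have := ler_norm (f t); lra.
by rewrite fine_asumZ// ger0_norm//; lra.
Qed.

Lemma tsum_le f (M : R) : (asum f <= M%:E)%E -> `|tsum f| <= M.
Proof.
move=> fM; have sf := asum_absum fM; apply: le_trans (tsum_norm sf) _.
by rewrite -lee_fin -absumE.
Qed.

Lemma tsumD f g : absum f -> absum g ->
  tsum (fun t => f t + g t) = tsum f + tsum g.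
Proof.
move=> sf sg; rewrite (@tsum_diff _ (fun t => (`|f t| + f t) + (`|g t| + g t))
  (fun t => `|f t| + `|g t|)).
- rewrite (fine_asumD (absum_pos sf) (absum_pos sg)); do ?by move=> t; exact: norm_add_ge0.
  by rewrite (fine_asumD (absum_norm sf) (absum_norm sg))// !tsumE; lra.
- by move=> t; lra.
- by move=> t; rewrite addr_ge0// norm_add_ge0.
- by move=> t; rewrite addr_ge0.
- by apply: absumD; exact: absum_pos.
- by apply: absumD; exact: absum_norm.
Qed.

Lemma tsumZ (a : R) f : absum f -> tsum (fun t => a * f t) = a * tsum f.
Proof.
move=> sf; have sp := absum_pos sf; have sn := absum_norm sf.
have [a0|a0] := leP 0 a.
  rewrite (@tsum_diff _ (fun t => a * (`|f t| + f t)) (fun t => a * `|f t|)).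
  - by rewrite (fine_asumZ a sp) (fine_asumZ a sn) tsumE ger0_norm//; lra.
  - by move=> t; lra.
  - by move=> t; rewrite mulr_ge0// norm_add_ge0.
  - by move=> t; rewrite mulr_ge0.
  - exact: absumZ.
  - exact: absumZ.
rewrite (@tsum_diff _ (fun t => (- a) * `|f t|) (fun t => (- a) * (`|f t| + f t))).
- by rewrite (fine_asumZ (- a) sp) (fine_asumZ (- a) sn) tsumE normrN ltr0_norm//; lra.
- by move=> t; lra.
- by move=> t; rewrite mulr_ge0// oppr_ge0 ltW.
- by move=> t; rewrite mulr_ge0// ?norm_add_ge0// oppr_ge0 ltW.
- exact: absumZ.
- exact: absumZ.
Qed.

Lemma tsumN f : absum f -> tsum (fun t => - f t) = - tsum f.
Proof.
move=> sf; rewrite -mulN1r -tsumZ//; congr tsum.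
by apply/funext => t; rewrite mulN1r.
Qed.

Lemma tsumB f g : absum f -> absum g ->
  tsum (fun t => f t - g t) = tsum f - tsum g.
Proof. by move=> sf sg; rewrite tsumD ?tsumN//; exact: absumN. Qed.

Lemma absum0 : absum (fun _ : T => 0 : R).
Proof. by rewrite /absum /asum esum1 ?ltry// => t _; rewrite normr0. Qed.

Lemma tsum0 : tsum (fun _ : T => 0 : R) = 0.
Proof.
rewrite -[X in tsum X](_ : (fun t : T => 0 * 0 : R) = _); last first.
  by apply/funext => t; rewrite mulr0.
by rewrite (tsumZ _ absum0) mul0r.
Qed.

Lemma tsum_sum (A : Type) (l : seq A) (F : A -> T -> R) :
  (forall j, absum (F j)) -> absum (fun t => \sum_(j <- l) F j t) /\
  tsum (fun t => \sum_(j <- l) F j t) = \sum_(j <- l) tsum (F j).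
Proof.
move=> sF; elim: l => [|j l [IH1 IH2]].
  rewrite (_ : (fun t => _) = fun=> 0); first by rewrite big_nil tsum0; split; first exact: absum0.
  by apply/funext => t; rewrite big_nil.
rewrite (_ : (fun t => _) = fun t => F j t + \sum_(j <- l) F j t).
  by rewrite big_cons -IH2 tsumD//; split => //; exact: absumD.
by apply/funext => t; rewrite big_cons.
Qed.

Lemma esum_seq (a : T -> \bar R) (s : seq T) : uniq s ->
  (forall t, 0 <= a t)%E -> (forall t, t \notin s -> a t = 0%E) ->
  \esum_(t in [set: T]) a t = (\sum_(t <- s) a t)%E.
Proof.
move=> us a0 as0.
transitivity (\esum_(t in [set` s]) a t).
  rewrite [RHS]esum_mkcond; apply: eq_esum => t _.
  by rewrite mem_setE; case: ifPn => // /as0.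
rewrite esum_fset; last 2 first.
- exact: finite_seq.
- by [].
by rewrite [RHS]fsbig_seq.
Qed.

Lemma asum_seq f (s : seq T) : uniq s -> (forall t, t \notin s -> f t = 0) ->
  asum f = (\sum_(t <- s) `|f t|)%:E.
Proof.
move=> us fs; rewrite /asum (esum_seq us) ?sumEFin//.
by move=> t /fs ->; rewrite normr0.
Qed.

Lemma absum_seq f (s : seq T) : uniq s -> (forall t, t \notin s -> f t = 0) ->
  absum f.
Proof. by move=> us fs; rewrite /absum (asum_seq us fs) ltry. Qed.

Lemma tsum_seq f (s : seq T) : uniq s -> (forall t, t \notin s -> f t = 0) ->
  tsum f = \sum_(t <- s) f t.
Proof.
move=> us fs; rewrite tsumE (asum_seq us) => [|t /fs ->]; last first.
  by rewrite normr0 addr0.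
rewrite (asum_seq us) => [|t /fs ->]; last by rewrite normr0.
rewrite /= -sumrB; apply: eq_bigr => t _.
by rewrite normr_id (ger0_norm (norm_add_ge0 _)); lra.
Qed.

Lemma sum_le_asum f (s : seq T) : uniq s -> ((\sum_(t <- s) `|f t|)%:E <= asum f)%E.
Proof.
move=> us; pose g t := if t \in s then f t else 0.
rewrite (_ : \sum_(t <- s) _ = \sum_(t <- s) `|g t|); last first.
  by apply: eq_big_seq => t ts; rewrite /g ts.
rewrite -(asum_seq us); last by move=> t; rewrite /g => /negPf ->.
by apply: le_asum => t; rewrite /g; case: ifP => // _; rewrite normr0.
Qed.

End OneIndex.

Section Reindex.
Context {T T' : choiceType}.
Implicit Types (f : T' -> R) (e : T -> T').

Lemma esum_reindex_supp (a : T' -> \bar R) e : injective e ->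
  (forall t, (forall x, e x <> t) -> a t = 0%E) ->
  \esum_(t in [set: T']) a t = \esum_(x in [set: T]) a (e x).
Proof.
move=> ie a0; rewrite -(@esum_image _ _ _ [set: T] e a); last by move=> x y _ _; exact: ie.
rewrite [RHS]esum_mkcond; apply: eq_esum => t _; case: ifPn => //.
rewrite notin_setE => H; apply: a0 => x xt; apply: H.
by exists x.
Qed.

Lemma asum_reindex f e : injective e ->
  (forall t, (forall x, e x <> t) -> f t = 0) -> asum (f \o e) = asum f.
Proof.
move=> ie f0; rewrite /asum (esum_reindex_supp ie)//.
by move=> t /f0 ->; rewrite normr0.
Qed.

Lemma tsum_reindex f e : injective e ->
  (forall t, (forall x, e x <> t) -> f t = 0) -> tsum (f \o e) = tsum f.
Proof.
move=> ie f0; rewrite !tsumE !asum_norm -(asum_reindex ie f0).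
rewrite -(@asum_reindex (fun t => `|f t| + f t) _ ie)//.
by move=> t /f0 ->; rewrite normr0 addr0.
Qed.

Lemma asum_inj_le f e : injective e -> (asum (f \o e) <= asum f)%E.
Proof.
move=> ie; pose g t := if pselect (exists x, e x = t) then f t else 0.
have -> : f \o e = g \o e.
  by apply/funext => x; rewrite /g /=; case: pselect => // -[]; exists x.
rewrite asum_reindex//.
  by apply: le_asum => t; rewrite /g; case: pselect => //= _; rewrite normr0.
move=> t H; rewrite /g; case: pselect => // -[x xt].
by have := H x xt.
Qed.

Lemma absum_inj f e : injective e -> absum f -> absum (f \o e).
Proof. by move=> ie; apply: le_lt_trans; exact: asum_inj_le. Qed.

End Reindex.

Section Pair.
Context {A B : choiceType}.
Implicit Types F : A * B -> R.

Lemma asum_pair F :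
  asum F = \esum_(a in [set: A]) asum (fun b => F (a, b)).
Proof.
rewrite /asum (@esum_esum _ _ _ _ (fun=> setT) (fun a b => `|F (a, b)|%:E))//.
by congr (esum _ _); [apply/seteqP; split|apply/funext => -[]].
Qed.

Lemma absum_row F a : absum F -> absum (fun b => F (a, b)).
Proof. by apply: (@absum_inj _ _ F (fun b => (a, b))) => b b' []. Qed.

Lemma asum_pair_fine F : absum F ->
  asum F = asum (fun a => fine (asum (fun b => F (a, b)))).
Proof.
move=> sF; rewrite asum_pair; apply: eq_esum => a _.
by rewrite ger0_norm ?asum_fine_ge0// -absumE//; exact: absum_row.
Qed.

Lemma absum_pair F : (forall a, absum (fun b => F (a, b))) ->
  absum (fun a => fine (asum (fun b => F (a, b)))) -> absum F.
Proof.
move=> s1; apply: le_lt_trans; rewrite asum_pair; apply: le_esum => a _.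
by rewrite ger0_norm ?asum_fine_ge0// -absumE.
Qed.

Lemma asum_tsum_row F : absum F ->
  (asum (fun a => tsum (fun b => F (a, b))) <= asum F)%E.
Proof.
move=> sF; rewrite asum_pair_fine//; apply: le_asum => a.
by rewrite (ger0_norm (asum_fine_ge0 _)) tsum_norm//; exact: absum_row.
Qed.

(** Fubini: Tonelli applies to the two nonnegative families behind [tsum], and [tsum_diff]
    recombines the row sums. *)
Lemma tsum_pair F : absum F ->
  tsum F = tsum (fun a => tsum (fun b => F (a, b))).
Proof.
move=> sF; have sp := absum_pos sF; have sn := absum_norm sF.
have H (G : A * B -> R) : absum G -> absum (fun a => fine (asum (fun b => G (a, b)))).
  by move=> sG; rewrite /absum -(asum_pair_fine sG).
rewrite tsumE (asum_pair_fine sp) (asum_pair_fine sn).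
rewrite -(@tsum_diff _ (fun a => tsum (fun b => F (a, b)))) //.
- by move=> a; rewrite tsumE.
- by move=> a; exact: asum_fine_ge0.
- by move=> a; exact: asum_fine_ge0.
- exact: H sp.
- exact: H sn.
Qed.

End Pair.

Section Swap.
Context {A B : choiceType}.

Lemma asum_swap (F : A * B -> R) : asum (fun p : B * A => F (p.2, p.1)) = asum F.
Proof.
apply: (@asum_reindex _ _ F (fun p : B * A => (p.2, p.1))).
  by move=> [b a] [b' a'] /= [-> ->].
by move=> [a b] /(_ (b, a)).
Qed.

Lemma tsum_swap (F : A * B -> R) : tsum (fun p : B * A => F (p.2, p.1)) = tsum F.
Proof.
apply: (@tsum_reindex _ _ F (fun p : B * A => (p.2, p.1))).
  by move=> [b a] [b' a'] /= [-> ->].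
by move=> [a b] /(_ (b, a)).
Qed.

Lemma absum_swap (F : A * B -> R) : absum F -> absum (fun p : B * A => F (p.2, p.1)).
Proof. by rewrite /absum asum_swap. Qed.

Lemma tsum_exchange (F : A * B -> R) : absum F ->
  tsum (fun a => tsum (fun b => F (a, b))) =
  tsum (fun b => tsum (fun a => F (a, b))).
Proof.
by move=> sF; rewrite -tsum_pair// -tsum_swap tsum_pair//; exact: absum_swap.
Qed.

End Swap.

(** Links unordered sums with limits of partial sums along any exhausting sequence of finite sets;
    the boxes in [real_analytic] are such a sequence. *)
Lemma cvg_tsum {T : choiceType} (f : T -> R) (s : nat -> seq T) :
  (forall N, uniq (s N)) ->
  (forall X : seq T, \forall N \near \oo, {subset X <= s N}) ->
  absum f -> (fun N => \sum_(t <- s N) f t) @ \oo --> tsum f.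
Proof.
move=> us ss sf.
have pos (a : T -> R) : (forall t, 0 <= a t) -> absum a ->
    (fun N => \sum_(t <- s N) a t) @ \oo --> fine (asum a).
  move=> a0 sa.
  have ub (X : seq T) : uniq X -> \sum_(t <- X) a t <= fine (asum a).
    move=> uX; rewrite -lee_fin -absumE//; apply: le_trans (sum_le_asum a uX).
    by rewrite lee_fin; apply: ler_sum => t _; rewrite ger0_norm.
  apply/cvgrPdist_le => e e0.
  have : ((fine (asum a) - e)%:E < asum a)%E.
    by rewrite [X in (_ < X)%E](absumE sa) lte_fin; lra.
  move=> /ereal_sup_gt[_ [X [fX _] <-]]; rewrite fsbig_finite//=.
  rewrite sumEFin lte_fin => eX.
  near=> N; have XN : {subset finmap.enum_fset (fset_set X) <= s N}.
    by near: N; exact: ss.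
  rewrite ger0_norm ?subr_ge0 ?ub//.
  suff : \sum_(t <- finmap.enum_fset (fset_set X)) `|a t| <= \sum_(t <- s N) a t by lra.
  rewrite [X in _ <= X](bigID (mem (finmap.enum_fset (fset_set X))) predT) /=.
  rewrite -[X in X <= _]addr0 lerD ?sumr_ge0//.
  under eq_bigr do rewrite ger0_norm//.
  rewrite -[X in _ <= X]big_filter le_eqVlt; apply/orP; left; apply/eqP.
  apply: perm_big; apply: uniq_perm; rewrite ?filter_uniq ?finmap.fset_uniq//.
  by move=> t; rewrite mem_filter; case: (boolP (t \in _)) => // /XN ->.
rewrite tsumE; have -> : (fun N => \sum_(t <- s N) f t) =
   (fun N => \sum_(t <- s N) (`|f t| + f t) - \sum_(t <- s N) `|f t|).
  by apply/funext => N; rewrite -sumrB; apply: eq_bigr => t _; lra.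
apply: cvgB; apply: pos => //.
- by move=> t; exact: norm_add_ge0.
- exact: absum_pos.
- exact: absum_norm.
Unshelve. all: by end_near. Qed.

End UnorderedSum.

(** * Two-variable coefficient arrays *)

Section Arrays.
Context {R : realType}.
Local Notation arr := (nat * nat -> R).
Implicit Types (u v w : arr) (k : nat * nat).

Definition idx_add k l : nat * nat := ((k.1 + l.1)%N, (k.2 + l.2)%N).
Definition idx_sub k l : nat * nat := ((k.1 - l.1)%N, (k.2 - l.2)%N).
Definition idx_le k l : bool := (k.1 <= l.1)%N && (k.2 <= l.2)%N.

Lemma idx_addK k l : idx_sub (idx_add k l) k = l.
Proof. by case: k l => [a b] [c d]; rewrite /idx_sub /= !addKn. Qed.

Lemma idx_subK k l : idx_le k l -> idx_add k (idx_sub l k) = l.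
Proof.
by case: k l => [a b] [c d] /andP[/= ac bd]; rewrite /idx_add /= !subnKC.
Qed.

Lemma idx_le_add k l : idx_le k (idx_add k l).
Proof. by rewrite /idx_le /= !leq_addr. Qed.

Definition idx_box k := [seq (a, b) | a <- iota 0 k.1.+1, b <- iota 0 k.2.+1].

Lemma uniq_idx_box k : uniq (idx_box k).
Proof. by apply: allpairs_uniq; rewrite ?iota_uniq// => -[a b] [a' b']. Qed.

Lemma mem_idx_box k l : (l \in idx_box k) = idx_le l k.
Proof.
apply/allpairsP/idP => [[[a b] []]|].
  by rewrite !mem_iota !ltnS /= => ak bk ->; rewrite /idx_le ak bk.
by move=> /andP[ak bk]; exists l; split; rewrite ?mem_iota ?ltnS//; case: (l).
Qed.

(** The Cauchy product: the coefficients of the product of two double power series. *)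
Definition amul u v : arr := fun k =>
  \sum_(a < k.1.+1) \sum_(b < k.2.+1)
    u (a : nat, b : nat) * v ((k.1 - a)%N, (k.2 - b)%N).

Lemma amulE u v k : amul u v k =
  tsum (fun l => if idx_le l k then u l * v (idx_sub k l) else 0).
Proof.
rewrite (@tsum_seq _ _ _ (idx_box k)).
- rewrite big_allpairs /amul -(big_mkord xpredT (fun a => \sum_(b < k.2.+1)
    u (a : nat, b : nat) * v ((k.1 - a)%N, (k.2 - b)%N))).
  rewrite /index_iota subn0; apply: eq_big_seq => a; rewrite mem_iota => /andP[_ ak].
  rewrite -(big_mkord xpredT (fun b =>
    u (a : nat, b : nat) * v ((k.1 - a)%N, (k.2 - b)%N))).
  rewrite /index_iota subn0; apply: eq_big_seq => b; rewrite mem_iota => /andP[_ bk].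
  by rewrite /idx_le /= -ltnS ak -ltnS bk.
- exact: uniq_idx_box.
- by move=> l; rewrite -mem_idx_box => /negPf ->.
Qed.

Section Convolution.
Variables (u v w1 w2 w : arr).
Hypothesis w10 : forall k, 0 <= w1 k.
Hypothesis w20 : forall k, 0 <= w2 k.
Hypothesis wM : forall k l, `|w (idx_add k l)| <= w1 k * w2 l.
Hypothesis uw1 : absum (fun k => u k * w1 k).
Hypothesis vw2 : absum (fun k => v k * w2 k).

(** Indexed by the index of the first factor and the index of the product. Summing over the second
    gives a sum over independent indices of [u] and [v], summing over the first gives [amul], so
    every claim about products is one exchange of sums. *)
Let G (p : (nat * nat) * (nat * nat)) : R :=
  if idx_le p.1 p.2 then u p.1 * v (idx_sub p.2 p.1) * w p.2 else 0.

Let GE k : (fun l => G (k, idx_add k l)) = (fun l => u k * v l * w (idx_add k l)).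
Proof. by apply/funext => l; rewrite /G /= idx_le_add idx_addK. Qed.

Let idx_add_inj k : injective (idx_add k).
Proof. by move=> l l' /(congr1 (idx_sub^~ k)); rewrite !idx_addK. Qed.

Let G0 k l : (forall l', idx_add k l' <> l) -> G (k, l) = 0.
Proof. by move=> H; rewrite /G /=; case: ifPn => // /idx_subK /H. Qed.

Let G_row k : (asum (fun l => G (k, l)) <=
   asum (fun l => (`|u k| * w1 k) * (v l * w2 l))%R)%E.
Proof.
rewrite -(asum_reindex (@idx_add_inj k) (@G0 k)) [_ \o _]GE.
apply: le_asum => l; rewrite !normrM normr_id (ger0_norm (w10 k)) (ger0_norm (w20 l)).
rewrite mulrACA ler_wpM2l ?mulr_ge0//; exact: wM.
Qed.

Let G_row_s k : absum (fun l => G (k, l)).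
Proof. by apply: le_lt_trans (G_row k) _; exact: absumZ. Qed.

Let G_s0 : absum (fun k => fine (asum (fun l => G (k, l)))).
Proof.
apply: (@le_absum _ _ _ (fun k => fine (asum (fun l => v l * w2 l)) * (u k * w1 k))).
  move=> k; rewrite ger0_norm ?asum_fine_ge0//.
  rewrite -lee_fin -absumE//; apply: le_trans (G_row k) _.
  rewrite asumZ (absumE vw2) -EFinM lee_fin !normrM !normr_id mulrC.
  by rewrite (ger0_norm (asum_fine_ge0 _)).
exact: absumZ.
Qed.

Let G_s : absum G. Proof. exact: absum_pair G_row_s G_s0. Qed.

Let G_le : (asum G <= asum (fun k => u k * w1 k)%R * asum (fun k => v k * w2 k)%R)%E.
Proof.
rewrite (absumE vw2) muleC -[X in (X%:E * _)%E]ger0_norm ?asum_fine_ge0// -asumZ.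
rewrite asum_pair_fine//; apply: le_asum => k.
rewrite ger0_norm ?asum_fine_ge0//.
rewrite -lee_fin -absumE//; apply: le_trans (G_row k) _.
rewrite asumZ (absumE vw2) -EFinM lee_fin !normrM !normr_id mulrC.
by rewrite (ger0_norm (asum_fine_ge0 _)).
Qed.

Let amulG : (fun k => amul u v k * w k) = (fun k => tsum (fun l => G (l, k))).
Proof.
apply/funext => k; rewrite amulE mulrC -tsumZ; last first.
  apply: (absum_seq (uniq_idx_box k)) => l.
  by rewrite -mem_idx_box => /negPf ->.
by congr tsum; apply/funext => l; rewrite /G /=; case: ifP; rewrite ?mulr0// mulrC.
Qed.

(** The product and the two factors have separate weights because [anorm_IyDx] measures a
    differentiated factor and an undifferentiated one differently. *)
Lemma asum_amul : (asum (fun k => amul u v k * w k)%R <=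
  asum (fun k => u k * w1 k)%R * asum (fun k => v k * w2 k)%R)%E.
Proof.
rewrite amulG; apply: le_trans G_le; rewrite -(asum_swap G).
by apply: (asum_tsum_row (F := fun p => G (p.2, p.1))); exact: absum_swap.
Qed.

Lemma absum_amul : absum (fun k => amul u v k * w k).
Proof.
by apply: le_lt_trans asum_amul _; rewrite (absumE uw1) (absumE vw2) -EFinM ltry.
Qed.

Lemma tsum_amul_row : tsum (fun k => amul u v k * w k) =
  tsum (fun k => tsum (fun l => u k * v l * w (idx_add k l))).
Proof.
rewrite amulG -(tsum_exchange (F := G))//; congr tsum; apply/funext => k.
by rewrite -(tsum_reindex (@idx_add_inj k) (@G0 k)) [_ \o _]GE.
Qed.

End Convolution.

Lemma tsum_amul u v w : (forall k l, w (idx_add k l) = w k * w l) ->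
  absum (fun k => u k * w k) -> absum (fun k => v k * w k) ->
  tsum (fun k => amul u v k * w k) =
  tsum (fun k => u k * w k) * tsum (fun k => v k * w k).
Proof.
move=> wM su sv.
have H x : absum (fun k => x k * w k) -> absum (fun k => x k * `|w k|).
  by apply: le_absum => k; rewrite !normrM normr_id.
rewrite (@tsum_amul_row u v (fun k => `|w k|) (fun k => `|w k|))//; last 3 first.
- by move=> k l; rewrite wM normrM.
- exact: H.
- exact: H.
rewrite mulrC -tsumZ//; congr tsum; apply/funext => k; rewrite [RHS]mulrC -tsumZ//.
by congr tsum; apply/funext => l; rewrite wM mulrACA.
Qed.

Lemma absum_amul_char u v w : (forall k l, w (idx_add k l) = w k * w l) ->
  absum (fun k => u k * w k) -> absum (fun k => v k * w k) ->
  absum (fun k => amul u v k * w k).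
Proof.
move=> wM su sv.
have H x : absum (fun k => x k * w k) -> absum (fun k => x k * `|w k|).
  by apply: le_absum => k; rewrite !normrM normr_id.
apply: (@absum_amul u v (fun k => `|w k|) (fun k => `|w k|)) => //.
- by move=> k l; rewrite wM normrM.
- exact: H.
- exact: H.
Qed.

End Arrays.

Section RowNorm.
Context {R : realType} {m : nat}.
Implicit Types x : 'rV[R]_m.

Lemma rv_norm_leP x (M : R) : 0 <= M ->
  reflect (forall i, `|x 0 i| <= M) (`|x| <= M).
Proof.
move=> M0; rewrite [`|x|]mx_normrE; apply: (iffP idP) => [H i|H].
  by apply: le_trans H; exact: (le_bigmax _ (fun ij : 'I_1 * 'I_m => `|x ij.1 ij.2|) (0, i)).
by apply: bigmax_le => // -[i j] _ /=; rewrite (ord1 i).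
Qed.

Lemma coord_norm_le x i : `|x 0 i| <= `|x|.
Proof. by apply/rv_norm_leP. Qed.

End RowNorm.

(** * Weighted norms of coefficient arrays and evaluation of the series *)

Section WeightedArrays.
Context {R : realType}.
Local Notation arr := (nat * nat -> R).
Implicit Types (u v w : arr) (k : nat * nat) (r s x y a b : R).

Definition chr x y k : R := x ^+ k.1 * y ^+ k.2.

Definition ev u x y : R := tsum (fun k => u k * chr x y k).

Lemma chrM x y k l : chr x y (idx_add k l) = chr x y k * chr x y l.
Proof. by rewrite /chr /= !exprD mulrACA. Qed.

(* With this weight the norm of [aIy (amul (aDx u) v)] is controlled without loss,
   since [wt r s (i, j + 1) / (j + 1) = s / r * (wt r s (i + 1, j) / (i + 1))]. *)
Definition wt r s k : R := r ^+ k.1 * s ^+ k.2 / 'C(k.1 + k.2, k.1)%:R.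

Definition anorm r s u : \bar R := asum (fun k => u k * wt r s k).

Lemma binSumE_gt0 k : 0 < 'C(k.1 + k.2, k.1)%:R :> R.
Proof. by rewrite ltr0n bin_gt0 leq_addr. Qed.

Lemma wt_ge0 r s k : 0 <= r -> 0 <= s -> 0 <= wt r s k.
Proof. by move=> r0 s0; rewrite divr_ge0// mulr_ge0// exprn_ge0. Qed.

Lemma leq_bin_mul m n i j : (i <= m)%N -> ('C(m, i) * 'C(n, j) <= 'C(m + n, i + j))%N.
Proof.
move=> im; have ij : (i < (i + j).+1)%N by rewrite ltnS leq_addr.
by rewrite -binomial.Vandermonde (bigD1 (Ordinal ij))//= addKn leq_addr.
Qed.

Lemma wtM r s k l : 0 <= r -> 0 <= s ->
  wt r s (idx_add k l) <= wt r s k * wt r s l.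
Proof.
move=> r0 s0; rewrite /wt /= !exprD.
rewrite mulf_div [X in X / _]mulrACA; apply: ler_wpM2l.
  by rewrite !mulr_ge0// exprn_ge0.
rewrite lef_pV2 ?posrE ?mulr_gt0 ?binSumE_gt0//; last exact: (binSumE_gt0 (idx_add k l)).
by rewrite -natrM ler_nat addnACA leq_bin_mul// leq_addr.
Qed.

(** The binomial coefficient in the weight is at most 2^(i + j), and halving both radii absorbs
    exactly this power. *)
Lemma chr_wt r s x y k : 0 <= r -> 0 <= s -> `|x| <= r / 2 -> `|y| <= s / 2 ->
  `|chr x y k| <= wt r s k.
Proof.
move=> r0 s0 xr ys; rewrite /chr /wt normrM !normrX.
apply: (@le_trans _ _ ((r / 2) ^+ k.1 * (s / 2) ^+ k.2)).
  by apply: ler_pM; rewrite ?exprn_ge0// lerXn2r// nnegrE// divr_ge0.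
rewrite !expr_div_n mulf_div ler_wpM2l ?mulr_ge0 ?exprn_ge0//.
rewrite lef_pV2 ?posrE ?binSumE_gt0 ?mulr_gt0 ?exprn_gt0//.
rewrite -exprD -natrX ler_nat -[2%N]/(1 + 1)%N Pascal.
have kk : (k.1 < (k.1 + k.2).+1)%N by rewrite ltnS leq_addr.
by rewrite (bigD1 (Ordinal kk))//= !exp1n !muln1 leq_addr.
Qed.

Lemma absum_ev r s u x y : 0 <= r -> 0 <= s -> `|x| <= r / 2 -> `|y| <= s / 2 ->
  absum (fun k => u k * wt r s k) -> absum (fun k => u k * chr x y k).
Proof.
move=> r0 s0 xr ys; apply: le_absum => k.
by rewrite normrM [leRHS]normrM ler_wpM2l// (ger0_norm (wt_ge0 k r0 s0)) chr_wt.
Qed.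

Lemma ev_le r s u x y b : 0 <= r -> 0 <= s -> `|x| <= r / 2 -> `|y| <= s / 2 ->
  (anorm r s u <= b%:E)%E -> `|ev u x y| <= b.
Proof.
move=> r0 s0 xr ys ub; apply: tsum_le; apply: le_trans ub; apply: le_asum => k.
by rewrite normrM [leRHS]normrM ler_wpM2l// (ger0_norm (wt_ge0 k r0 s0)) chr_wt.
Qed.

Lemma anorm_absum r s u b : (anorm r s u <= b%:E)%E ->
  absum (fun k => u k * wt r s k).
Proof. exact: asum_absum. Qed.

Lemma anorm_amul r s u v a b : 0 <= r -> 0 <= s -> (anorm r s u <= a%:E)%E ->
  (anorm r s v <= b%:E)%E -> (anorm r s (amul u v) <= (a * b)%:E)%E.
Proof.
move=> r0 s0 ua vb; rewrite EFinM.
apply: (@le_trans _ _ (anorm r s u * anorm r s v)%E); last first.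
  by apply: lee_pmul => //; exact: asum_ge0.
apply: asum_amul; try by move=> k; exact: wt_ge0.
- by move=> k l; rewrite ger0_norm ?wt_ge0// wtM.
- exact: anorm_absum ua.
- exact: anorm_absum vb.
Qed.

Lemma ev_amul u v x y : absum (fun k => u k * chr x y k) ->
  absum (fun k => v k * chr x y k) -> ev (amul u v) x y = ev u x y * ev v x y.
Proof. by move=> su sv; apply: tsum_amul => // k l; rewrite chrM. Qed.

Definition aDx u : arr := fun k => k.1.+1%:R * u (k.1.+1, k.2).
Definition aDy u : arr := fun k => k.2.+1%:R * u (k.1, k.2.+1).
Definition aIy u : arr := fun k =>
  if k.2 is j.+1 then u (k.1, j) / j.+1%:R else 0.

Lemma anorm_IyE r s u :
  anorm r s (aIy u) = asum (fun k => u k * (wt r s (k.1, k.2.+1) / k.2.+1%:R)).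
Proof.
rewrite /anorm -(@asum_reindex _ _ _ _ (fun k => (k.1, k.2.+1))).
- by congr asum; apply/funext => -[i j] /=; rewrite mulrAC mulrA.
- by move=> [i j] [i' j'] [-> ->].
- by move=> [i [|j]] H; [rewrite mul0r|have := H (i, j)].
Qed.

Lemma wt_Iy r s k : 0 <= r -> 0 <= s ->
  wt r s (k.1, k.2.+1) / k.2.+1%:R <= s * wt r s k.
Proof.
move=> r0 s0; rewrite /wt /= exprS -mulrA -invfM mulrCA -!mulrA.
rewrite ler_wpM2l// !mulrA ler_wpM2l ?mulr_ge0 ?exprn_ge0//.
rewrite lef_pV2 ?posrE ?mulr_gt0 ?(binSumE_gt0 k) ?(binSumE_gt0 (k.1, k.2.+1)) ?ltr0n//.
rewrite -natrM ler_nat addnS; apply: leq_trans (leq_pmulr _ _) => //.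
by apply: leq_bin2l.
Qed.

Lemma anorm_Iy r s u b : 0 <= r -> 0 <= s -> (anorm r s u <= b%:E)%E ->
  (anorm r s (aIy u) <= (s * b)%:E)%E.
Proof.
move=> r0 s0 ub; rewrite anorm_IyE.
apply: (@le_trans _ _ (asum (fun k => s * (u k * wt r s k)))); last first.
  by rewrite asumZ ger0_norm// EFinM lee_wpmul2l.
apply: le_asum => k; rewrite [X in _ <= `|X|]mulrCA normrM [leRHS]normrM ler_wpM2l//.
rewrite !ger0_norm; first exact: wt_Iy.
  by rewrite mulr_ge0 ?wt_ge0.
by rewrite divr_ge0 ?wt_ge0.
Qed.

(** This is the identity (i + 1) C(i + j + 1, i + 1) = (j + 1) C(i + j + 1, i), the reason for the
    binomial coefficient in [wt]. *)
Lemma wt_shift r s k : 0 < r ->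
  wt r s (k.1, k.2.+1) / k.2.+1%:R = s / r * (wt r s (k.1.+1, k.2) / k.1.+1%:R).
Proof.
move=> r0; case: k => i j; rewrite /wt /= addnS addSn.
have /(congr1 (fun n => n%:R : R)) := mul_bin_left (i + j).+1 i.
rewrite !natrM -addnS addKn => E.
have b1 := binSumE_gt0 (i, j.+1); have b2 := binSumE_gt0 (i.+1, j).
rewrite /= addSn -?addnS in b1 b2; rewrite !exprS.
have i0 : i.+1%:R != 0 :> R by rewrite pnatr_eq0.
have j0 : j.+1%:R != 0 :> R by rewrite pnatr_eq0.
have -> : r * r ^+ i * s ^+ j / 'C(i + j.+1, i.+1)%:R / i.+1%:R =
  r * r ^+ i * s ^+ j / (i.+1%:R * 'C(i + j.+1, i.+1)%:R).
  by rewrite invfM mulrA mulrAC.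
rewrite E; field.
by rewrite (gt_eqF r0) (gt_eqF b1) addrC natr1 j0.
Qed.

(** By [wt_shift] the integrated product is measured by [s / r] times a shifted weight. That weight
    is compatible with [wt] under products, since dividing by a larger first index only makes it
    smaller. *)
Lemma anorm_IyDx r s u v a b : 0 < r -> 0 <= s -> (anorm r s u <= a%:E)%E ->
  (anorm r s v <= b%:E)%E ->
  (anorm r s (aIy (amul (aDx u) v)) <= (s / r * (a * b))%:E)%E.
Proof.
move=> r0 s0 ua vb; rewrite anorm_IyE.
have r0' := ltW r0.
(* The weight that turns [aDx] into a shift: [aDx u k * w1 k] is the next entry of [u] in the
   x-direction times its own [wt]. *)
pose w1 k : R := wt r s (k.1.+1, k.2) / k.1.+1%:R.
have w10 k : 0 <= w1 k by rewrite divr_ge0// wt_ge0.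
have u1 : (asum (fun k => aDx u k * w1 k)%R <= a%:E)%E.
  apply: le_trans ua; rewrite (_ : (fun k => _) =
    (fun k => u k * wt r s k) \o (fun k => (k.1.+1, k.2))).
    by apply: asum_inj_le => -[i j] [i' j'] [-> ->].
  apply/funext => k /=; rewrite /aDx /w1 [_%:R * _]mulrC -mulrA; congr (_ * _).
  by rewrite mulrC divfK// pnatr_eq0.
rewrite (_ : (fun k => _) = (fun k => s / r * (amul (aDx u) v k * w1 k))); last first.
  by apply/funext => k; rewrite wt_shift// [RHS]mulrCA.
rewrite asumZ ger0_norm ?divr_ge0// [leRHS]EFinM lee_wpmul2l ?lee_fin ?divr_ge0// EFinM.
apply: (@le_trans _ _ (asum (fun k => aDx u k * w1 k)%R * anorm r s v)%E); last first.
  by apply: lee_pmul => //; exact: asum_ge0.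
apply: asum_amul => //.
- by move=> k; rewrite wt_ge0.
- move=> k l; rewrite ger0_norm//.
  rewrite /w1 [leRHS]mulrAC; apply: ler_pM.
  + by rewrite wt_ge0.
  + by rewrite invr_ge0.
  + exact: (wtM (k.1.+1, k.2) l).
  + by rewrite lef_pV2 ?posrE ?ltr0n// ler_nat ltnS leq_addr.
- exact: asum_absum u1.
- exact: asum_absum vb.
Qed.

End WeightedArrays.

(** * Termwise differentiation *)

Section Remainders.
Context {R : realType}.
Implicit Types A B t a b d : R.

(* [a] and [b] are values at two points, [d] the linear part of [b - a].  These
   bounds are stable under products, with [A] and [A'] multiplied. *)
Definition taylor1 A A' t a b d : Prop :=
  [/\ `|a| <= A, `|b - a| <= t * (A' - A) & `|b - a - d| <= t ^+ 2 * (A' - A)].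

(** The expansion b b' - a a' = (b - a) a' + a (b' - a') + (b - a) (b' - a') is majorised term by
    term by the same expansion of A' B' - A B. The mixed term is of order t^2, and t <= 1 lets it
    enter the first-order bound too. *)
Lemma taylor1_mul A A' B B' t a b d a' b' d' : 0 <= t <= 1 ->
  0 <= A <= A' -> 0 <= B <= B' ->
  taylor1 A A' t a b d -> taylor1 B B' t a' b' d' ->
  taylor1 (A * B) (A' * B') t (a * a') (b * b') (a * d' + d * a').
Proof.
move=> /andP[t0 t1] /andP[A0 AA] /andP[B0 BB] [a1 a2 a3] [b1 b2 b3].
have tt : t ^+ 2 <= t by rewrite expr2 ler_piMl.
have DA : 0 <= A' - A by rewrite subr_ge0.
have DB : 0 <= B' - B by rewrite subr_ge0.
have t20 : 0 <= t ^+ 2 by rewrite sqr_ge0.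
have E : `|(b - a) * (b' - a')| <= t ^+ 2 * ((A' - A) * (B' - B)).
  rewrite normrM expr2 [leRHS](_ : _ = (t * (A' - A)) * (t * (B' - B))); last ring.
  exact: ler_pM.
split.
- by rewrite normrM ler_pM.
- rewrite (_ : b * b' - a * a' = (b - a) * a' + a * (b' - a') + (b - a) * (b' - a')); last ring.
  apply: (@le_trans _ _ (t * (A' - A) * B + A * (t * (B' - B)) + t * ((A' - A) * (B' - B)))).
    apply: le_trans (ler_normD _ _) _; apply: lerD.
      by apply: le_trans (ler_normD _ _) _; rewrite !normrM; apply: lerD; apply: ler_pM.
    by apply: le_trans E _; rewrite ler_wpM2r// mulr_ge0.
  by rewrite le_eqVlt; apply/orP; left; apply/eqP; ring.
- rewrite (_ : b * b' - a * a' - _ =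
    (b - a - d) * a' + a * (b' - a' - d') + (b - a) * (b' - a')); last ring.
  apply: (@le_trans _ _ (t ^+ 2 * (A' - A) * B + A * (t ^+ 2 * (B' - B)) +
      t ^+ 2 * ((A' - A) * (B' - B)))).
    apply: le_trans (ler_normD _ _) _; apply: lerD => //.
    by apply: le_trans (ler_normD _ _) _; rewrite !normrM; apply: lerD; apply: ler_pM.
  by rewrite le_eqVlt; apply/orP; left; apply/eqP; ring.
Qed.

Lemma taylor1_const t a : 0 <= t -> taylor1 `|a| `|a| t a a 0.
Proof. by split; rewrite ?subrr ?subr0 ?normr0 ?mulr0. Qed.

Lemma taylor1_exp A A' t a b d n : 0 <= t <= 1 -> 0 <= A <= A' ->
  taylor1 A A' t a b d ->
  taylor1 (A ^+ n) (A' ^+ n) t (a ^+ n) (b ^+ n) (n%:R * a ^+ n.-1 * d).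
Proof.
move=> t01 AA T; elim: n => [|n IH].
  rewrite !expr0 !mul0r -[X in taylor1 X]normr1 -[X in taylor1 _ X]normr1.
  by apply: taylor1_const; case/andP: t01.
have := taylor1_mul t01 AA _ T IH; rewrite -!exprS.
have -> : a * (n%:R * a ^+ n.-1 * d) + d * a ^+ n = n.+1%:R * a ^+ n.+1.-1 * d.
  case: n {IH} => [|n] /=; first by rewrite !expr0; ring.
  by rewrite exprS -[n.+2%:R]natr1; ring.
apply; case/andP: AA => A0 AA'; rewrite exprn_ge0//= lerXn2r// nnegrE//.
exact: le_trans AA'.
Qed.

(** The base case: with a margin [rho] around the point, an increment [h] uses up the fraction t =
    |h| / rho of it and leaves no remainder. *)
Lemma taylor1_coord (rho x h : R) : 0 < rho -> `|h| <= rho ->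
  taylor1 `|x| (`|x| + rho) (`|h| / rho) x (x + h) h.
Proof.
move=> r0 hr; rewrite /taylor1 [`|x| + rho]addrC addrK [x + h]addrC addrK subrr normr0.
by rewrite divfK ?gt_eqF// lexx; split => //; rewrite mulr_ge0 ?sqr_ge0// ltW.
Qed.

Lemma taylor1_le A A' t t' a b d : 0 <= t <= t' -> A <= A' ->
  taylor1 A A' t a b d -> taylor1 A A' t' a b d.
Proof.
move=> /andP[t0 tt] AA [h1 h2 h3]; have D : 0 <= A' - A by rewrite subr_ge0.
split=> //; first by apply: le_trans h2 _; rewrite ler_wpM2r.
by apply: le_trans h3 _; rewrite ler_wpM2r// lerXn2r// nnegrE// (le_trans t0).
Qed.

Section Series.
Context {T : choiceType}.
Variables (c A A' a b d : T -> R) (t : R).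
Hypothesis t01 : 0 <= t <= 1.
Hypothesis AA : forall k, 0 <= A k <= A' k.
Hypothesis Tk : forall k, taylor1 (A k) (A' k) t (a k) (b k) (d k).
Hypothesis sA : absum (fun k => c k * A' k).

Let A'0 k : 0 <= A' k. Proof. by have /andP[/le_trans] := AA k; apply. Qed.

Let sle (f : T -> R) (M : R) : (forall k, `|f k| <= M * A' k) -> absum (fun k => c k * f k).
Proof.
move=> fM; apply: le_absum (absumZ M sA) => k.
rewrite mulrCA normrM [leRHS]normrM ler_wpM2l//; apply: le_trans (fM k) _.
exact: ler_norm.
Qed.

Lemma taylor1_absum : [/\ absum (fun k => c k * a k), absum (fun k => c k * b k) &
  absum (fun k => c k * d k)].
Proof.
case/andP: t01 => t0 t1.
have tt : t ^+ 2 <= 1 by rewrite expr_le1.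
have na k : `|a k| <= 1 * A' k.
  by have [h _ _] := Tk k; have /andP[_ AA'] := AA k; rewrite mul1r (le_trans h).
have nba k : `|b k - a k| <= A' k.
  have [_ h _] := Tk k; have /andP[A0 AA'] := AA k; apply: le_trans h _.
  apply: (@le_trans _ _ (1 * (A' k - A k))); last by rewrite mul1r gerBl.
  by rewrite ler_wpM2r// subr_ge0.
have nbad k : `|b k - a k - d k| <= A' k.
  have [_ _ h] := Tk k; have /andP[A0 AA'] := AA k; apply: le_trans h _.
  apply: (@le_trans _ _ (1 * (A' k - A k))); last by rewrite mul1r gerBl.
  by rewrite ler_wpM2r// subr_ge0.
split; first exact: sle na.
- apply: (@sle _ 2) => k; rewrite -[b k](subrK (a k)) mulr_natl mulr2n.
  apply: le_trans (ler_normD _ _) _; apply: lerD => //.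
  by have := na k; rewrite mul1r.
- apply: (@sle _ 2) => k.
  rewrite (_ : d k = (b k - a k) - (b k - a k - d k)) ?mulr_natl ?mulr2n; last ring.
  by apply: le_trans (ler_normB _ _) _; exact: lerD.
Qed.

(** The constant is the sum of the majorant at the enlarged point, the same for all increments, so
    quadratic remainders sum to a quadratic remainder. Termwise differentiation follows without
    uniform convergence of the differentiated series. *)
Lemma taylor1_tsum :
  `|tsum (fun k => c k * b k) - tsum (fun k => c k * a k) - tsum (fun k => c k * d k)|
  <= t ^+ 2 * fine (asum (fun k => c k * A' k)).
Proof.
have [s1 s2 s3] := taylor1_absum.
rewrite -tsumB// -tsumB//; last exact: absumB.
rewrite -[t ^+ 2]ger0_norm ?sqr_ge0// -fine_asumZ//.
apply: tsum_le; rewrite -absumE; last exact: absumZ.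
apply: le_asum => k; rewrite -!mulrBr mulrCA normrM [leRHS]normrM ler_wpM2l//.
have [_ _ h] := Tk k; apply: le_trans h _; apply: le_trans (ler_norm _).
by rewrite ler_wpM2l ?sqr_ge0// gerBl; have /andP[] := AA k.
Qed.

End Series.

(** The hypotheses are elementary so that [l] can be an explicit formula. It is packaged as a
    continuous linear map inside the proof, and uniqueness of the differential identifies the
    two. *)
Lemma quadratic_diff (V : normedModType R) (f : V -> R) (z : V) (l : V -> R)
    (C M rho : R) :
  0 < rho -> (forall k u v, l (k *: u + v) = k * l u + l v) ->
  (forall h, `|l h| <= C * `|h|) ->
  (forall h, `|h| <= rho -> `|f (z + h) - f z - l h| <= M * `|h| ^+ 2) ->
  differentiable f z /\ 'd f z = l :> (V -> R).
Proof.
move=> rho0 lin lC H; pose lM := GRing.isLinear.Build _ _ _ _ l lin.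
pose L : {linear V -> R} := HB.pack l lM.
have lc : continuous L.
  move=> x; apply/cvgrPdist_le => e e0; near=> y.
  rewrite -[L x - L y]linearB; apply: le_trans (lC _) _.
  have C1 : 0 < `|C| + 1 by rewrite ltr_wpDl.
  apply: (@le_trans _ _ ((`|C| + 1) * `|x - y|)).
    by rewrite ler_wpM2r// (le_trans (ler_norm C))// lerDl.
  rewrite -(ler_pdivlMl _ _ C1); near: y.
  by apply: cvgr_dist_le; [exact: cvg_id|rewrite mulr_gt0// invr_gt0].
rewrite -[l]/(L : V -> R).
have E : f \o shift z = cst (f z) + L +o_ 0 id.
  apply/eqaddoP => _/posnumP[e].
  near=> h.
  rewrite /= -[(_ - _) h]/(f (h + z) - (f z + l h)) opprD addrA [h + z]addrC.
  apply: le_trans (H h _) _.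
    by near: h; exact: nbhs0_le.
  rewrite expr2 mulrA ler_wpM2r//.
  apply: (@le_trans _ _ ((`|M| + 1) * `|h|)).
    by rewrite ler_wpM2r// (le_trans (ler_norm M))// lerDl.
  have M1 : 0 < `|M| + 1 by rewrite ltr_wpDl.
  rewrite -(ler_pdivlMl _ _ M1); near: h; apply: nbhs0_le; rewrite mulr_gt0// invr_gt0.
have dl : 'd f z = L :> (V -> R) by exact: diff_unique.
by split => //; apply/diff_locallyP; rewrite dl.
Unshelve. all: by end_near. Qed.

End Remainders.

Section EvDiff.
Context {R : realType}.
Local Notation arr := (nat * nat -> R).
Implicit Types (u : arr) (rho sigma x y : R).

(** Summability at each point of an open bidisc, rather than a bound on [anorm], because [aDx] and
    [aDy] preserve it without shrinking the radii. *)
Definition ev_absum rho sigma u : Prop := forall x y, `|x| < rho -> `|y| < sigma ->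
  absum (fun k => u k * chr x y k).

Lemma ev_absum_anorm r s u b : 0 < r -> 0 < s -> (anorm r s u <= b%:E)%E ->
  ev_absum (r / 2) (s / 2) u.
Proof.
move=> r0 s0 ub x y xr ys; apply: (absum_ev (ltW r0) (ltW s0) (ltW xr) (ltW ys)).
exact: anorm_absum ub.
Qed.

Let dchr x y (h : R * R) (k : nat * nat) : R :=
  x ^+ k.1 * (k.2%:R * y ^+ k.2.-1 * h.2) + k.1%:R * x ^+ k.1.-1 * h.1 * y ^+ k.2.

Lemma taylor1_chr x y (h : R * R) delta k : 0 < delta -> `|h| <= delta ->
  taylor1 (chr `|x| `|y| k) (chr (`|x| + delta) (`|y| + delta) k) (`|h| / delta)
    (chr x y k) (chr (x + h.1) (y + h.2) k) (dchr x y h k).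
Proof.
move=> d0 hd; have := hd; rewrite prod_normE ge_max => /andP[h1 h2].
have t01 : 0 <= `|h| / delta <= 1 by rewrite divr_ge0 ?(ltW d0)//= ler_pdivrMr// mul1r.
have nd (z : R) : 0 <= `|z| <= `|z| + delta by rewrite normr_ge0 lerDl ltW.
have ndX (z : R) n : 0 <= `|z| ^+ n <= (`|z| + delta) ^+ n.
  by have /andP[z0 zz] := nd z; rewrite exprn_ge0//= lerXn2r// nnegrE// addr_ge0// ltW.
have T (z k' : R) n : `|k'| <= `|h| -> taylor1 (`|z| ^+ n) ((`|z| + delta) ^+ n)
     (`|h| / delta) (z ^+ n) ((z + k') ^+ n) (n%:R * z ^+ n.-1 * k').
  move=> kh; apply: taylor1_exp => //; apply: (taylor1_le (t := `|k'| / delta)).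
  - by rewrite divr_ge0 ?(ltW d0)//= ler_wpM2r// invr_ge0 ltW.
  - by case/andP: (nd z).
  - by apply: taylor1_coord => //; exact: le_trans hd.
by apply: taylor1_mul => //; apply: T; rewrite prod_normE le_max lexx ?orbT.
Qed.

Section AtPoint.
Variables (rho sigma x y : R) (u : arr).
Hypothesis su : ev_absum rho sigma u.
Hypothesis xr : `|x| < rho.
Hypothesis ys : `|y| < sigma.

(** Half of the remaining room, so that the majorant point [(|x| + delta, |y| + delta)] is still
    inside the open bidisc. *)
Let delta := Num.min (rho - `|x|) (sigma - `|y|) / 2.

Let d0 : 0 < delta.
Proof. by rewrite divr_gt0// lt_min !subr_gt0 xr. Qed.

Let sA : absum (fun k => u k * chr (`|x| + delta) (`|y| + delta) k).
Proof.
have d2 : 2 * delta <= rho - `|x| /\ 2 * delta <= sigma - `|y|.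
  by rewrite /delta mulrC divfK// !ge_min !lexx orbT.
by apply: su; rewrite ger0_norm ?addr_ge0 ?(ltW d0)//; move: d2 d0; lra.
Qed.

Let AA k : 0 <= chr `|x| `|y| k <= chr (`|x| + delta) (`|y| + delta) k.
Proof.
have dd := ltW d0; rewrite /chr mulr_ge0 ?exprn_ge0//=.
by apply: ler_pM; rewrite ?exprn_ge0// lerXn2r// ?nnegrE ?addr_ge0// lerDl.
Qed.

Let ab h : `|h| <= delta -> [/\ absum (fun k => u k * chr x y k),
  absum (fun k => u k * chr (x + h.1) (y + h.2) k) & absum (fun k => u k * dchr x y h k)].
Proof.
move=> hd; have t01 : 0 <= `|h| / delta <= 1.
  by rewrite divr_ge0 ?(ltW d0)//= ler_pdivrMr// mul1r.
exact: (taylor1_absum t01 AA (fun k => taylor1_chr x y k d0 hd) sA).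
Qed.

Let nd (h : R * R) : `|h.1| <= delta -> `|h.2| <= delta -> `|h| <= delta.
Proof. by move=> h1 h2; rewrite prod_normE ge_max h1 h2. Qed.

Let sDx : absum (fun k => u k * (k.1%:R * x ^+ k.1.-1 * y ^+ k.2)).
Proof.
(* The linear part of the increment along the first axis is [delta] times the x-derivative of the
   terms, so its summability gives that of the derived series. *)
have hd : `|(delta, 0) : R * R| <= delta by rewrite nd //= ?normr0 ?gtr0_norm ?(ltW d0).
have [_ _] := ab hd.
move=> /(absumZ delta^-1); apply: le_absum => k.
rewrite /dchr /= mulr0 mulr0 add0r le_eqVlt; apply/orP; left; apply/eqP; congr (`|_|).
field; exact: lt0r_neq0.
Qed.

Let sDy : absum (fun k => u k * (x ^+ k.1 * (k.2%:R * y ^+ k.2.-1))).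
Proof.
have hd : `|(0, delta) : R * R| <= delta by rewrite nd //= ?normr0 ?gtr0_norm ?(ltW d0).
have [_ _] := ab hd.
move=> /(absumZ delta^-1); apply: le_absum => k.
rewrite /dchr /= mulr0 mul0r addr0 le_eqVlt; apply/orP; left; apply/eqP; congr (`|_|).
field; exact: lt0r_neq0.
Qed.

Let exE : (fun k => aDx u k * chr x y k) =
  (fun k => u k * (k.1%:R * x ^+ k.1.-1 * y ^+ k.2)) \o (fun k => (k.1.+1, k.2)).
Proof. by apply/funext => -[i j]; rewrite /aDx /chr /=; ring. Qed.

Let eyE : (fun k => aDy u k * chr x y k) =
  (fun k => u k * (x ^+ k.1 * (k.2%:R * y ^+ k.2.-1))) \o (fun k => (k.1, k.2.+1)).
Proof. by apply/funext => -[i j]; rewrite /aDy /chr /=; ring. Qed.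

Let ix : injective (fun k : nat * nat => (k.1.+1, k.2)).
Proof. by move=> [i j] [i' j'] [-> ->]. Qed.

Let iy : injective (fun k : nat * nat => (k.1, k.2.+1)).
Proof. by move=> [i j] [i' j'] [-> ->]. Qed.

Lemma absum_aDx : absum (fun k => aDx u k * chr x y k).
Proof. by rewrite exE; exact: absum_inj. Qed.

Lemma absum_aDy : absum (fun k => aDy u k * chr x y k).
Proof. by rewrite eyE; exact: absum_inj. Qed.

Lemma ev_is_diff :
  differentiable (fun z : R * R => ev u z.1 z.2) (x, y) /\
  'd (fun z : R * R => ev u z.1 z.2) (x, y) =
    (fun h : R * R => h.1 * ev (aDx u) x y + h.2 * ev (aDy u) x y) :> (R * R -> R).
Proof.
pose a := ev (aDx u) x y; pose b := ev (aDy u) x y.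
apply: (@quadratic_diff _ _ _ _ _ (`|a| + `|b|)
  (delta ^- 2 * fine (asum (fun k => u k * chr (`|x| + delta) (`|y| + delta) k))) delta) => //.
- by move=> k v w /=; rewrite -[k *: v.1]/(k * v.1) -[k *: v.2]/(k * v.2); ring.
- move=> h /=; apply: le_trans (ler_normD _ _) _; rewrite !normrM mulrDl.
  by rewrite ![_ * `|h|]mulrC; apply: lerD; rewrite ler_wpM2r// prod_normE le_max lexx ?orbT.
move=> h hd /=.
have t01 : 0 <= `|h| / delta <= 1 by rewrite divr_ge0 ?(ltW d0)//= ler_pdivrMr// mul1r.
have := taylor1_tsum t01 AA (fun k => taylor1_chr x y k d0 hd) sA.
rewrite (_ : tsum (fun k => u k * dchr x y h k) = h.1 * a + h.2 * b); last first.
  rewrite /a /b /ev exE eyE !tsum_reindex//; last 2 first.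
  - by move=> [i [|j]] H; [rewrite mul0r !mulr0|have := H (i, j)].
  - by move=> [[|i] j] H; [rewrite !mul0r mulr0|have := H (i, j)].
  rewrite -!tsumZ// -tsumD; [|exact: absumZ|exact: absumZ].
  by congr tsum; apply/funext => k; rewrite /dchr; ring.
by move=> /le_trans; apply; rewrite expr_div_n mulrAC mulrC [X in _ * X]mulrC mulrA.
Qed.

End AtPoint.

Lemma ev_absum_aDx rho sigma u : ev_absum rho sigma u -> ev_absum rho sigma (aDx u).
Proof. by move=> su x y xr ys; apply: absum_aDx su xr ys. Qed.

Lemma ev_absum_aDy rho sigma u : ev_absum rho sigma u -> ev_absum rho sigma (aDy u).
Proof. by move=> su x y xr ys; apply: absum_aDy su xr ys. Qed.

End EvDiff.

(** * Composition with analytic functions *)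

Section Lifting.
Context {R : realType}.
Local Notation arr := (nat * nat -> R).

(** Analyticity at one point, with the limit of box sums replaced by the unordered sum, on which
    products and exchanges of sums are available. *)
Definition pser {m : nat} (f : 'rV[R]_m -> R) (a : 'rV[R]_m)
    (c : {ffun 'I_m -> nat} -> R) (rho : R) : Prop :=
  forall h : 'rV[R]_m, `|h| < rho ->
    absum (fun al => c al * monomial al h) /\
    f (a + h) = tsum (fun al => c al * monomial al h).

Definition aconst (c : R) : arr := fun k => if k == (0, 0)%N then c else 0.

Lemma aconst_supp (c : R) (w : arr) k : k \notin [:: (0, 0)%N] -> aconst c k * w k = 0.
Proof. by rewrite inE /aconst => /negPf ->; rewrite mul0r. Qed.

Lemma anorm_aconst (r s c : R) : anorm r s (aconst c) = `|c|%:E.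
Proof.
rewrite /anorm (asum_seq (s := [:: (0, 0)%N]))//; last exact: aconst_supp.
by rewrite big_seq1 /aconst eqxx /wt /= !expr0 bin0 divr1 !mulr1.
Qed.

Lemma ev_aconst (c x y : R) : ev (aconst c) x y = c.
Proof.
rewrite /ev (tsum_seq (s := [:: (0, 0)%N]))//; last exact: aconst_supp.
by rewrite big_seq1 /aconst eqxx /chr /= !expr0 !mulr1.
Qed.

Lemma absum_aconst (c x y : R) : absum (fun k => aconst c k * chr x y k).
Proof. by apply: (absum_seq (s := [:: (0, 0)%N])); last exact: aconst_supp. Qed.

Definition agree (j : nat) (u v : arr) : Prop :=
  forall a b, (b < j)%N -> u (a, b) = v (a, b).

Lemma agree_amul j u u' v v' : agree j u u' -> agree j v v' ->
  agree j (amul u v) (amul u' v').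
Proof.
move=> uu vv a b bj; apply: eq_bigr => a' _; apply: eq_bigr => b' _ /=.
have b'j : (b' < j)%N by apply: leq_ltn_trans bj; rewrite -ltnS.
by rewrite uu// vv// (leq_ltn_trans (leq_subr _ _) bj).
Qed.

Definition aexp (u : arr) (n : nat) : arr := iter n (amul u) (aconst 1).

Definition amon {m : nat} (us : 'I_m -> arr) (al : {ffun 'I_m -> nat}) : arr :=
  \big[amul/aconst 1]_(i < m) aexp (us i) (al i).

Lemma anorm_aexp r s u b n : 0 <= r -> 0 <= s -> (anorm r s u <= b%:E)%E ->
  (anorm r s (aexp u n) <= (b ^+ n)%:E)%E.
Proof.
move=> r0 s0 ub; elim: n => [|n IH] /=.
  by rewrite anorm_aconst normr1 expr0.
by rewrite exprS anorm_amul.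
Qed.

Lemma anorm_amon m r s (us : 'I_m -> arr) b al : 0 <= r -> 0 <= s ->
  (forall i, (anorm r s (us i) <= b%:E)%E) ->
  (anorm r s (amon us al) <= (\prod_i b ^+ al i)%:E)%E.
Proof.
move=> r0 s0 ub; rewrite /amon.
apply: (big_rec2 (fun (u : arr) (x : R) => (anorm r s u <= x%:E)%E)).
  by rewrite anorm_aconst normr1.
by move=> i x u _ ux; apply: anorm_amul => //; exact: anorm_aexp.
Qed.

Lemma ev_aexp u x y n : absum (fun k => u k * chr x y k) ->
  absum (fun k => aexp u n k * chr x y k) /\ ev (aexp u n) x y = ev u x y ^+ n.
Proof.
move=> su; elim: n => [|n [IH1 IH2]] /=.
  by rewrite ev_aconst; split => //; exact: absum_aconst.
by rewrite ev_amul// IH2 exprS; split => //; apply: absum_amul_char => // k l; rewrite chrM.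
Qed.

Lemma ev_amon m (us : 'I_m -> arr) x y al :
  (forall i, absum (fun k => us i k * chr x y k)) ->
  ev (amon us al) x y = \prod_i ev (us i) x y ^+ al i.
Proof.
move=> su; suff [] : absum (fun k => amon us al k * chr x y k) /\
   ev (amon us al) x y = \prod_i ev (us i) x y ^+ al i by [].
rewrite /amon; apply: (big_rec2 (fun (u : arr) (z : R) =>
  absum (fun k => u k * chr x y k) /\ ev u x y = z)).
  by rewrite ev_aconst; split => //; exact: absum_aconst.
move=> i z u _ [su1 <-]; have [s2 e2] := ev_aexp (al i) (su i).
by rewrite ev_amul// e2; split => //; apply: absum_amul_char => // k l; rewrite chrM.
Qed.

Lemma agree_amon m j (us vs : 'I_m -> arr) al : (forall i, agree j (us i) (vs i)) ->
  agree j (amon us al) (amon vs al).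
Proof.
move=> uv; rewrite /amon; apply: (big_rec2 (agree j)) => // i u v _ uv'.
apply: agree_amul => //; elim: (al i) => //= n; exact: agree_amul.
Qed.

Section Operators.
Context {I : Type}.
Implicit Types (F : (I -> R) -> R) (Phi : (I -> arr) -> arr).

(* [Phi] computes the coefficients of [F] applied to power series, uniformly on
   the balls of radius [eps] of all the weighted norms. *)
Definition lifts (eps : R) F Phi (K : R) : Prop :=
  forall r s, 0 < r -> 0 < s -> forall u : I -> arr,
    (forall i, (anorm r s (u i) <= eps%:E)%E) ->
    (anorm r s (Phi u) <= K%:E)%E /\
    forall x y, `|x| <= r / 2 -> `|y| <= s / 2 ->
      ev (Phi u) x y = F (fun i => ev (u i) x y).

(** The output up to a given order in y depends on the input only up to that order. One integration
    in y then makes the dependence strict. *)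
Definition causal Phi : Prop := forall j u v,
  (forall i, agree j (u i) (v i)) -> agree j (Phi u) (Phi v).

Definition liftable (eps : R) F : Prop :=
  exists Phi K, lifts eps F Phi K /\ causal Phi.

Lemma liftable_const eps c : liftable eps (fun=> c).
Proof.
exists (fun=> aconst c), `|c|; split => [r s r0 s0 u _|//].
by split => [|x y _ _]; [rewrite anorm_aconst|rewrite ev_aconst].
Qed.

Lemma liftable_var eps i : liftable eps (fun a => a i).
Proof.
exists (fun u => u i), eps; split => [r s r0 s0 u ub|j u v uv]; last exact: uv.
by split.
Qed.

Lemma liftableD eps F F' : liftable eps F -> liftable eps F' ->
  liftable eps (fun a => F a + F' a).
Proof.
move=> [P [K [PK cP]]] [P' [K' [PK' cP']]].
exists (fun u k => P u k + P' u k), (K + K'); split; last first.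
  by move=> j u v uv a b bj; rewrite (cP _ _ _ uv)// (cP' _ _ _ uv).
move=> r s r0 s0 u ub.
have [n1 e1] := PK r s r0 s0 u ub; have [n2 e2] := PK' r s r0 s0 u ub.
split.
  rewrite EFinD; apply: le_trans (leeD n1 n2).
  rewrite /anorm (_ : (fun k => _) = (fun k => P u k * wt r s k + P' u k * wt r s k)).
    exact: asumD.
  by apply/funext => k; rewrite mulrDl.
move=> x y xr ys; rewrite -e1// -e2//.
have H b v : (anorm r s v <= b%:E)%E -> absum (fun k => v k * chr x y k).
  by move=> /anorm_absum; apply: absum_ev => //; exact: ltW.
rewrite /ev -tsumD; [|exact: H n1|exact: H n2].
by congr tsum; apply/funext => k; rewrite mulrDl.
Qed.

Lemma liftableM eps F F' : liftable eps F -> liftable eps F' ->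
  liftable eps (fun a => F a * F' a).
Proof.
move=> [P [K [PK cP]]] [P' [K' [PK' cP']]].
exists (fun u => amul (P u) (P' u)), (K * K'); split; last first.
  by move=> j u v uv; apply: agree_amul; [exact: cP|exact: cP'].
move=> r s r0 s0 u ub.
have [n1 e1] := PK r s r0 s0 u ub; have [n2 e2] := PK' r s r0 s0 u ub.
split; first by apply: anorm_amul => //; exact: ltW.
have H b v x y : `|x| <= r / 2 -> `|y| <= s / 2 ->
   (anorm r s v <= b%:E)%E -> absum (fun k => v k * chr x y k).
  by move=> xr ys /anorm_absum; apply: absum_ev => //; exact: ltW.
by move=> x y xr ys; rewrite ev_amul ?e1 ?e2//; [exact: H n1|exact: H n2].
Qed.

Lemma liftable_sum eps (A : Type) (l : seq A) (F : A -> (I -> R) -> R) :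
  (forall j, liftable eps (F j)) -> liftable eps (fun a => \sum_(j <- l) F j a).
Proof.
move=> HF; elim: l => [|j l IH].
  rewrite (_ : (fun=> _) = fun=> 0); first exact: liftable_const.
  by apply/funext => a; rewrite big_nil.
rewrite (_ : (fun=> _) = fun a => F j a + \sum_(j <- l) F j a); first exact: liftableD.
by apply/funext => a; rewrite big_cons.
Qed.

(** Arrays may be substituted into the series because the norm is submultiplicative: the term of
    multi-index [al] has norm at most |c al| eps^|al|, which is summable as [eps < rho]. The
    resulting bound is independent of r and s. The map [e] selects the unknowns on which [f]
    depends. *)
Lemma liftable_pser m (f : 'rV[R]_m -> R) p c rho eps (e : 'I_m -> I) :
  pser f p c rho -> 0 <= eps < rho ->
  liftable eps (fun a => f (p + \row_i a (e i))).
Proof.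
move=> fp /andP[eps0 epsrho].
pose B (al : {ffun 'I_m -> nat}) : R := \prod_i eps ^+ al i.
have B0 al : 0 <= B al by apply: prodr_ge0 => i _; exact: exprn_ge0.
have sB : absum (fun al => c al * B al).
  have [|+ _] := fp (const_mx eps).
    apply: le_lt_trans epsrho; apply/rv_norm_leP => // i.
    by rewrite mxE ger0_norm.
  rewrite (_ : (fun al => _) = (fun al => c al * B al))//.
  by apply/funext => al; congr (_ * _); apply: eq_bigr => i _; rewrite mxE.
exists (fun u k => tsum (fun al => c al * amon (u \o e) al k)), (fine (asum (fun al => c al * B al))).
split; last first.
  move=> j u v uv a b bj; congr tsum; apply/funext => al; congr (_ * _).
  by apply: agree_amon bj => i; exact: uv.
move=> r s r0 s0 u ub.
have [r0' s0'] := (ltW r0, ltW s0).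
have ub' i : (anorm r s ((u \o e) i) <= eps%:E)%E by exact: ub.
have nA al : (anorm r s (amon (u \o e) al) <= (B al)%:E)%E by exact: anorm_amon.
(* One summable family for any weight below [wt]: the weight [wt] itself yields the norm bound, and
   [chr x y] the value of the composition. *)
have G (w : arr) : (forall k, `|w k| <= wt r s k) ->
   absum (fun q : {ffun 'I_m -> nat} * (nat * nat) => c q.1 * (amon (u \o e) q.1 q.2 * w q.2)) /\
   (asum (fun q : {ffun 'I_m -> nat} * (nat * nat) => c q.1 * (amon (u \o e) q.1 q.2 * w q.2))%R
     <= asum (fun al => c al * B al)%R)%E.
  move=> ww.
  have row al : (asum (fun k => (c al * (amon (u \o e) al k * w k))%R) <= `|c al * B al|%:E)%E.
    rewrite asumZ normrM EFinM lee_wpmul2l//; apply: (@le_trans _ _ (B al)%:E); last first.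
      by rewrite lee_fin ler_norm.
    apply: le_trans (nA al); apply: le_asum => k; rewrite normrM [leRHS]normrM.
    by rewrite ler_wpM2l// (ger0_norm (wt_ge0 k r0' s0')).
  have row2 al : fine (asum (fun k => c al * (amon (u \o e) al k * w k))) <= `|c al * B al|.
    by rewrite -lee_fin -absumE//; exact: asum_absum (row al).
  set H := (fun q : {ffun 'I_m -> nat} * (nat * nat) => _).
  have sH : absum H.
    apply: absum_pair => [al|]; first exact: asum_absum (row al).
    apply: le_absum sB => al; rewrite [leLHS]ger0_norm ?asum_fine_ge0//.
    exact: row2.
  split => //; rewrite asum_pair_fine//; apply: le_asum => al.
  rewrite [leLHS]ger0_norm ?asum_fine_ge0//; exact: row2.
have tsE (w : arr) k : (forall k, `|w k| <= wt r s k) ->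
   tsum (fun al => c al * amon (u \o e) al k) * w k =
   tsum (fun al => c al * (amon (u \o e) al k * w k)).
  (* Where the weight vanishes both sides are 0; elsewhere dividing by it gives the summability that
     [tsumZ] asks for. *)
  move=> ww; have [w0|w0] := eqVneq (w k) 0.
    rewrite w0 mulr0 (@tsum_seq _ _ _ [::]) ?big_nil// => al _.
    by rewrite !mulr0.
  have [/absum_swap sG _] := G w ww.
  have := absum_row k sG => /= sk.
  rewrite mulrC -tsumZ.
    by congr tsum; apply/funext => al; rewrite mulrCA [w k * _]mulrC.
  apply: le_absum (absumZ (w k)^-1 sk) => al.
  by rewrite mulrA [_ * (_ * w k)]mulrCA mulrA [_ * c al]mulrC -!mulrA mulrCA mulVf// mulr1.
split.
  have ww k : `|wt r s k| <= wt r s k by rewrite ger0_norm// wt_ge0.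
  have [sG lG] := G _ ww; rewrite -absumE//; apply: le_trans lG.
  rewrite -asum_swap; apply: le_trans (asum_tsum_row (absum_swap sG)).
  by apply: le_asum => k /=; rewrite tsE.
move=> x y xr ys.
have ww k : `|chr x y k| <= wt r s k by exact: chr_wt.
have [sG _] := G _ ww.
rewrite /ev; under eq_fun do rewrite tsE//.
rewrite -(tsum_exchange sG) /=.
have [|_ ->] := fp (\row_i ev (u (e i)) x y).
  apply: le_lt_trans epsrho; apply/rv_norm_leP => // i.
  by rewrite mxE; apply: ev_le (ub (e i)).
congr tsum; apply/funext => al; rewrite tsumZ; last first.
  have := anorm_absum (nA al); exact: absum_ev.
congr (_ * _); rewrite -/(ev _ _ _) ev_amon.
  by apply: eq_bigr => i _; rewrite mxE.
by move=> i; have := anorm_absum (ub' i); exact: absum_ev.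
Qed.

Lemma liftable_le eps eps' F : eps' <= eps -> liftable eps F -> liftable eps' F.
Proof.
move=> ee [P [K [PK cP]]]; exists P, K; split => // r s r0 s0 u ub.
by apply: PK => // i; apply: le_trans (ub i) _; rewrite lee_fin.
Qed.

End Operators.

End Lifting.

(** * The Cauchy-Kowalevski theorem *)

Section CauchyKowalevski.
Context {R : realType}.
Local Notation arr := (nat * nat -> R).

Lemma anorm_sum (r s : R) (A : Type) (l : seq A) (u : A -> arr) (b : A -> R) :
  (forall j, (anorm r s (u j) <= (b j)%:E)%E) ->
  (anorm r s (fun k => \sum_(j <- l) u j k)%R <= (\sum_(j <- l) b j)%:E)%E.
Proof.
move=> ub; elim: l => [|j l IH].
  rewrite big_nil /anorm (asum_seq (s := [::]))// ?big_nil// => k _.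
  by rewrite big_nil mul0r.
rewrite big_cons EFinD; apply: le_trans (leeD (ub j) IH).
rewrite /anorm (_ : (fun k => _) =
  (fun k => u j k * wt r s k + (\sum_(j <- l) u j k) * wt r s k)).
  exact: asumD.
by apply/funext => k; rewrite big_cons mulrDl.
Qed.

Lemma anormD (r s : R) (u v : arr) a b : (anorm r s u <= a%:E)%E ->
  (anorm r s v <= b%:E)%E -> (anorm r s (fun k => u k + v k)%R <= (a + b)%:E)%E.
Proof.
move=> ua vb; rewrite EFinD; apply: le_trans (leeD ua vb).
rewrite /anorm (_ : (fun k => _) = (fun k => u k * wt r s k + v k * wt r s k)).
  exact: asumD.
by apply/funext => k; rewrite mulrDl.
Qed.

Lemma ev_sum (A : Type) (l : seq A) (u : A -> arr) x y :
  (forall j, absum (fun k => u j k * chr x y k)) ->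
  absum (fun k => (\sum_(j <- l) u j k) * chr x y k) /\
  ev (fun k => \sum_(j <- l) u j k) x y = \sum_(j <- l) ev (u j) x y.
Proof.
move=> su; have := tsum_sum l su; rewrite /ev; set F := (fun k => _).
by rewrite (_ : (fun k => _) = F)//; apply/funext => k; rewrite /F mulr_suml.
Qed.

Definition ainit (a : nat -> R) : arr := fun k => if k.2 == 0%N then a k.1 else 0.

(** Since the constant term vanishes, every remaining term gains a factor r / r0; this is how
    shrinking r makes the initial data small. *)
Lemma anorm_ainit (a : nat -> R) (r s r0 : R) : 0 <= r <= r0 -> 0 < r0 -> a 0%N = 0 ->
  absum (fun i => a i * r0 ^+ i) ->
  (anorm r s (ainit a) <= (r / r0 * fine (asum (fun i => a i * r0 ^+ i)))%:E)%E.
Proof.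
move=> /andP[rge0 rr0] r00 a0 sa.
rewrite /anorm -(@asum_reindex _ _ _ _ (fun i => (i, 0%N))).
- have rr : 0 <= r / r0 by rewrite divr_ge0// ltW.
  rewrite [leRHS]EFinM -absumE// -[X in X%:E](ger0_norm rr).
  rewrite -asumZ; apply: le_asum => -[|i] /=; first by rewrite /ainit /= a0 !mul0r !mulr0.
  rewrite /ainit /wt /= addn0 binn divr1 expr0 mulr1 mulrCA normrM [leRHS]normrM.
  rewrite ler_wpM2l// !ger0_norm ?mulr_ge0 ?exprn_ge0 ?invr_ge0 ?(ltW r00)//.
  rewrite !exprS mulrA divfK ?gt_eqF// ler_wpM2l// lerXn2r// nnegrE//; exact: ltW.
- by move=> i j [].
- move=> [i [|j]] H; first by have := H i.
  by rewrite /ainit /= mul0r.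
Qed.

Context {I : finType}.
Variables (A : I -> I -> (I -> R) -> R) (B : I -> (I -> R) -> R) (eps : R).
Hypothesis eps0 : 0 < eps.
Hypothesis lA : forall l k, liftable eps (A l k).
Hypothesis lB : forall k, liftable eps (B k).
Variables (a : I -> nat -> R) (r0 : R).
Hypothesis r00 : 0 < r0.
Hypothesis sa : forall k, absum (fun i => a k i * r0 ^+ i).
Hypothesis a0 : forall k, a k 0%N = 0.

(** The data take up half of the ball of radius [eps] and the integrated right side the other
    half. *)
Theorem cauchy_kowalevski : exists (r s : R) (u : I -> arr),
  [/\ 0 < r, 0 < s, forall k, (anorm r s (u k) <= eps%:E)%E,
      forall k i, u k (i, 0%N) = a k i &
      forall k x y, `|x| < r / 2 -> `|y| < s / 2 ->
        ev (aDy (u k)) x y =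
        \sum_l ev (aDx (u l)) x y * A l k (fun i => ev (u i) x y) +
        B k (fun i => ev (u i) x y)].
Proof.
have /choice[PA /= HPA] : forall p : I * I, exists Phi : (I -> arr) -> arr,
    exists K, lifts eps (A p.1 p.2) Phi K /\ causal Phi by move=> p; exact: lA.
have /choice[KA {}HPA] := HPA.
have /choice[PB HPB] := lB.
have /choice[KB {}HPB] := HPB.
pose S := \sum_k fine (asum (fun i => a k i * r0 ^+ i)).
have S0 : 0 <= S by apply: sumr_ge0 => k _; exact: asum_fine_ge0.
have S1 k : fine (asum (fun i => a k i * r0 ^+ i)) <= S.
  by rewrite /S [leRHS](bigD1 k)//= lerDl sumr_ge0// => j _; exact: asum_fine_ge0.
clearbody S.
have D0 : 0 < eps + 2 * (S + 1) by move: eps0; lra.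
(* The ratio r / r0 is below 1, and times [S] it is at most eps / 2. *)
pose r := r0 * (eps / (eps + 2 * (S + 1))).
have r_gt0 : 0 < r by rewrite !mulr_gt0// invr_gt0.
have rr0 : r <= r0.
  rewrite -[leRHS]mulr1 ler_wpM2l ?(ltW r00)// ler_pdivrMr//.
  by move: eps0; lra.
have rS z : 0 <= z -> z <= S -> r / r0 * z <= eps / 2.
  move=> z0 zS; rewrite /r [r0 * _]mulrC mulfK ?gt_eqF// mulrAC ler_pdivrMr//.
  by have := ler_wpM2l (ltW eps0) zS; have := sqr_ge0 eps; rewrite expr2; move: eps0; lra.
clearbody r.
(* Up to the factor s, a bound for the integrated right side over the whole ball. It involves r but
   not s, so s may be chosen after it. *)
pose M := (\sum_k \sum_l eps * `|KA (l, k)|) / r + \sum_k `|KB k|.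
have M1 k : (\sum_l eps * `|KA (l, k)|) / r + `|KB k| <= M.
  apply: lerD; last by rewrite [leRHS](bigD1 k)//= lerDl sumr_ge0.
  rewrite ler_wpM2r ?invr_ge0 ?(ltW r_gt0)// [leRHS](bigD1 k)//= lerDl sumr_ge0// => j _.
  by rewrite sumr_ge0// => l _; rewrite mulr_ge0// ltW.
have M0 : 0 <= M.
  rewrite addr_ge0 ?divr_ge0 ?(ltW r_gt0)// sumr_ge0// => k _.
  by rewrite sumr_ge0// => l _; rewrite mulr_ge0// ltW.
clearbody M.
pose s := eps / (2 * (M + 1)).
have s_gt0 : 0 < s by rewrite divr_gt0//; lra.
have sM1 : s * M <= eps / 2.
  rewrite /s mulrAC ler_pdivrMr; last lra.
  by have := mulr_ge0 (ltW eps0) M0; move: eps0; lra.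
clearbody s.
have r_ge0 := ltW r_gt0; have s_ge0 := ltW s_gt0.
(* The integral form of the equation, whose fixed points satisfy both the equation and the initial
   condition. *)
pose T (u : I -> arr) k : arr := fun q => ainit (a k) q +
  ((\sum_l aIy (amul (aDx (u l)) (PA (l, k) u)) q) + aIy (PB k u) q).
have nT u : (forall k, (anorm r s (u k) <= eps%:E)%E) ->
    forall k, (anorm r s (T u k) <= eps%:E)%E.
  move=> ub k.
  have n1 : (anorm r s (ainit (a k)) <= (eps / 2)%:E)%E.
    apply: le_trans (anorm_ainit _ _ r00 (a0 k) (sa k)) _; first by rewrite r_ge0.
    by rewrite lee_fin rS// asum_fine_ge0.
  have nA l : (anorm r s (aIy (amul (aDx (u l)) (PA (l, k) u))) <=
      (s / r * (eps * `|KA (l, k)|))%:E)%E.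
    apply: anorm_IyDx => //; have [/(_ r s r_gt0 s_gt0 u ub)[+ _] _] := HPA (l, k).
    by move=> /le_trans; apply; rewrite lee_fin ler_norm.
  have nB : (anorm r s (aIy (PB k u)) <= (s * `|KB k|)%:E)%E.
    apply: anorm_Iy => //; have [/(_ r s r_gt0 s_gt0 u ub)[+ _] _] := HPB k.
    by move=> /le_trans; apply; rewrite lee_fin ler_norm.
  have := anormD n1 (anormD (anorm_sum (index_enum I) nA) nB).
  move=> /le_trans; apply; rewrite lee_fin -mulr_sumr.
  rewrite -mulrA -mulrDr [r^-1 * _]mulrC.
  by have := ler_wpM2l s_ge0 (M1 k); lra.
have cT j (u v : I -> arr) : (forall k, agree j (u k) (v k)) ->
    forall k, agree j.+1 (T u k) (T v k).
  (* At order 0 in y only the initial data contribute; order j' + 1 is read through [aIy] at order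
     j'. *)
  move=> uv k i [|j']; first by rewrite /T /aIy /= !big1.
  rewrite ltnS => jj.
  rewrite /T /aIy /=; congr (_ + (_ + _ / _)).
    apply: eq_bigr => l _; congr (_ / _).
    have [_ /(_ j u v uv) cP] := HPA (l, k).
    apply: (@agree_amul _ j _ _ _ _ _ cP i j' jj) => i1 j1 jj1.
    by rewrite /aDx /= uv.
  by have [_ /(_ j u v uv) cP] := HPB k; exact: cP.
pose U n : I -> arr := iter n T (fun _ _ => 0).
have nU n k : (anorm r s (U n k) <= eps%:E)%E.
  elim: n k => [|n IH] k; last exact: nT.
  rewrite /anorm (asum_seq (s := [::]))// ?big_nil ?lee_fin ?ltW// => q _.
  by rewrite mul0r.
have aU n m k : (n <= m)%N -> agree n (U n k) (U m k).
  move=> /subnKC <-; elim: (m - n)%N => [|d IH]; first by rewrite addn0.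
  suff {IH}: forall p, forall k, agree p (U p k) (U p.+1 k).
    move=> H i j jn; rewrite addnS IH//.
    by apply: (H (n + d)%N k); rewrite (leq_trans jn)// leq_addr.
  by elim=> [//|p IH']; exact: cT.
(* The coefficient of y^j no longer changes from the iterate j + 1 on, and is read off there. *)
pose u k : arr := fun q => U q.2.+1 k q.
have au n k : agree n (U n k) (u k) by move=> i j jn; apply/esym; exact: (aU j.+1 n k jn i j (ltnSn j)).
have nu k : (anorm r s (u k) <= eps%:E)%E.
  (* All entries in the finite set [X] are final in the iterate N + 1, which lies in the ball. *)
  apply: asum_approx => X; pose N := \max_(q <- X) q.2.
  exists (fun q => U N.+1 k q * wt r s q) => [|q qX]; first exact: nU.
  case: q qX => i j qX; congr (_ * _); apply/esym/(au N.+1).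
  by rewrite ltnS; apply: (@leq_bigmax_seq _ X predT (fun q : nat * nat => q.2) (i, j)).
have uE k q : u k q = T u k q.
  case: q => i j; rewrite {1}/u /=.
  by apply: cT => // k'; exact: au.
exists r, s, u; split => //.
  by move=> k i; rewrite uE /T /ainit /aIy /= big1 ?addr0.
move=> k x y xr ys.
have uT : aDy (u k) = (fun q => (\sum_l amul (aDx (u l)) (PA (l, k) u) q) + PB k u q).
  apply/funext => -[i j]; rewrite /aDy uE /T /ainit /aIy /= add0r -mulr_suml -mulrDl.
  by rewrite mulrC divfK// pnatr_eq0.
have sD l : absum (fun q => aDx (u l) q * chr x y q).
  by apply: (absum_aDx _ xr ys); apply: ev_absum_anorm (nu l).
have HA l : absum (fun q => PA (l, k) u q * chr x y q) /\
    ev (PA (l, k) u) x y = A l k (fun i => ev (u i) x y).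
  have [/(_ r s r_gt0 s_gt0 u nu)[n1 e1] _] := HPA (l, k); split.
    by apply: (absum_ev r_ge0 s_ge0 (ltW xr) (ltW ys)); exact: anorm_absum n1.
  by rewrite e1 ?ltW.
have [/(_ r s r_gt0 s_gt0 u nu)[nB eB] _] := HPB k.
have sB : absum (fun q => PB k u q * chr x y q).
  by apply: (absum_ev r_ge0 s_ge0 (ltW xr) (ltW ys)); exact: anorm_absum nB.
have sM l : absum (fun q => amul (aDx (u l)) (PA (l, k) u) q * chr x y q).
  by apply: absum_amul_char; [move=> *; rewrite chrM|exact: sD|case: (HA l)].
have [sS eS] := ev_sum (index_enum I) sM.
rewrite uT -eB ?ltW//.
transitivity (ev (fun q => \sum_l amul (aDx (u l)) (PA (l, k) u) q) x y + ev (PB k u) x y).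
  rewrite /ev -tsumD//; congr tsum; apply/funext => q; exact: mulrDl.
rewrite eS; congr (_ + _); apply: eq_bigr => l _.
by have [s1 <-] := HA l; rewrite ev_amul.
Qed.

End CauchyKowalevski.

(** * Power series in several variables *)

Section PowerSeriesDiff.
Context {R : realType}.

Lemma taylor1_prod (I : eqType) (s : seq I) (A A' a b d : I -> R) (t : R) :
  0 <= t <= 1 -> (forall i, 0 <= A i <= A' i) ->
  (forall i, taylor1 (A i) (A' i) t (a i) (b i) (d i)) -> uniq s ->
  taylor1 (\prod_(i <- s) A i) (\prod_(i <- s) A' i) t
    (\prod_(i <- s) a i) (\prod_(i <- s) b i)
    (\sum_(i <- s) d i * \prod_(j <- s | j != i) a j).
Proof.
move=> t01 AA T; elim: s => [_|i s IH /= /andP[nis us]].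
  rewrite !big_nil -[X in taylor1 X]normr1 -[X in taylor1 _ X]normr1.
  by apply: taylor1_const; case/andP: t01.
have A0 j : 0 <= A j by case/andP: (AA j).
have P : 0 <= \prod_(j <- s) A j <= \prod_(j <- s) A' j.
  by rewrite prodr_ge0 ?ler_prod.
have := taylor1_mul t01 (AA i) P (T i) (IH us).
rewrite -!(big_cons _ _ i s xpredT).
rewrite (_ : _ + d i * _ = \sum_(k <- i :: s) d k * \prod_(j <- i :: s | j != k) a j)//.
rewrite [RHS]big_cons addrC; congr (_ + _).
  rewrite big_cons eqxx /=; congr (_ * _); rewrite [RHS]big_seq_cond [LHS]big_seq.
  apply: eq_bigl => j; case: (boolP (j \in s)) => //= js.
  by apply/esym; apply: contraNneq nis => <-.
rewrite big_distrr /=; apply: eq_big_seq => k ks.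
rewrite big_cons ifT; first by rewrite mulrCA.
by apply: contraNneq nis => ->.
Qed.

Section AtPoint.
Context {m : nat}.
Implicit Types (h k : 'rV[R]_m) (al be : {ffun 'I_m -> nat}) (c : {ffun 'I_m -> nat} -> R).

(** The i-th partial derivative of the monomial; the truncated predecessor is harmless because its
    factor vanishes when the exponent is 0. *)
Definition mdx (i : 'I_m) al h : R :=
  (al i)%:R * h 0 i ^+ (al i).-1 * \prod_(j | j != i) h 0 j ^+ al j.

Definition incr_idx (i : 'I_m) al : {ffun 'I_m -> nat} := [ffun j => (al j + (j == i))%N].

Definition cdx (i : 'I_m) c : {ffun 'I_m -> nat} -> R :=
  fun al => (al i).+1%:R * c (incr_idx i al).

Lemma incr_idx_inj i : injective (incr_idx i).
Proof.
move=> al be /ffunP E; apply/ffunP => j; have := E j.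
by rewrite !ffunE => /addIn.
Qed.

Lemma incr_idx_supp i al : (forall be, incr_idx i be <> al) -> al i = 0%N.
Proof.
move=> H; case E : (al i) => [//|n]; exfalso.
apply: (H [ffun j => (al j - (j == i))%N]); apply/ffunP => j; rewrite !ffunE.
case: eqP => [->|_]; last by rewrite subn0 addn0.
by rewrite E subn1 addn1.
Qed.

Lemma cdxE i c h :
  (fun al => cdx i c al * monomial al h) = (fun al => c al * mdx i al h) \o incr_idx i.
Proof.
apply/funext => al /=; rewrite /cdx /mdx /monomial ffunE eqxx addn1 /= -!mulrA.
rewrite [LHS]mulrCA; congr (_ * (_ * _)).
rewrite (bigD1 i)//=; congr (_ * _); apply: eq_bigr => j /negPf ji.
by rewrite ffunE ji addn0.
Qed.

Section Point.
Variables (f : 'rV[R]_m -> R) (p : 'rV[R]_m) (c : {ffun 'I_m -> nat} -> R) (rho : R).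
Variable h : 'rV[R]_m.
Hypothesis fp : pser f p c rho.
Hypothesis hr : `|h| < rho.

Let delta := (rho - `|h|) / 2.
Let d0 : 0 < delta. Proof. by rewrite divr_gt0// subr_gt0. Qed.

Let h' : 'rV[R]_m := \row_i (`|h 0 i| + delta).

Let sA : absum (fun al => c al * monomial al h').
Proof.
apply: (fp _).1; apply: (@le_lt_trans _ _ (`|h| + delta)); last by rewrite /delta; move: hr; lra.
apply/rv_norm_leP => [|i]; first by rewrite addr_ge0// ltW.
by rewrite mxE ger0_norm ?addr_ge0 ?(ltW d0)// lerD2r coord_norm_le.
Qed.

Let habs : 'rV[R]_m := \row_i `|h 0 i|.

Let nd (z : R) : 0 <= `|z| <= `|z| + delta.
Proof. by rewrite normr_ge0 lerDl ltW. Qed.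

Let ndX (z : R) n : 0 <= `|z| ^+ n <= (`|z| + delta) ^+ n.
Proof.
have /andP[z0 zz] := nd z.
by rewrite exprn_ge0//= lerXn2r// nnegrE// addr_ge0// ltW.
Qed.

Let AA al : 0 <= monomial al habs <= monomial al h'.
Proof.
rewrite /monomial prodr_ge0 => [|i _]; last by rewrite mxE exprn_ge0.
apply: ler_prod => i _; rewrite !mxE; exact: ndX.
Qed.

Let t01 k : `|k| <= delta -> 0 <= `|k| / delta <= 1.
Proof. by move=> kd; rewrite divr_ge0 ?(ltW d0)//= ler_pdivrMr// mul1r. Qed.

Let T k al : `|k| <= delta ->
  taylor1 (monomial al habs) (monomial al h') (`|k| / delta)
    (monomial al h) (monomial al (h + k)) (\sum_i k 0 i * mdx i al h).
Proof.
move=> kd; rewrite (_ : \sum_i _ = \sum_i ((al i)%:R * h 0 i ^+ (al i).-1 * k 0 i) *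
   \prod_(j | j != i) h 0 j ^+ al j).
  apply: taylor1_prod; rewrite ?index_enum_uniq//.
  - exact: t01.
  - by move=> i; rewrite !mxE.
  - move=> i; rewrite !mxE; apply: taylor1_exp => //; first exact: t01.
    have ki := coord_norm_le k i.
    apply: (taylor1_le (t := `|k 0 i| / delta)).
    + by rewrite divr_ge0 ?(ltW d0)//= ler_wpM2r// invr_ge0 ltW.
    + by case/andP: (nd (h 0 i)).
    + by apply: taylor1_coord => //; exact: le_trans kd.
by apply: eq_bigr => i _; rewrite /mdx mulrA [k 0 i * _]mulrC.
Qed.

Let smdx i : absum (fun al => c al * mdx i al h).
Proof.
pose k : 'rV[R]_m := delta *: delta_mx 0 i.
have kd : `|k| <= delta.
  apply/rv_norm_leP => [|j]; first exact: ltW.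
  rewrite !mxE /=; case: eqP => _; rewrite ?mulr1 ?mulr0 ?normr0 ?ger0_norm//; exact: ltW.
have [_ _] := taylor1_absum (t01 kd) AA (fun al => T al kd) sA.
move=> /(absumZ delta^-1); apply: le_absum => al.
rewrite (bigD1 i)//= big1 ?addr0 => [|j /negPf ji]; last first.
  by rewrite !mxE /= ji mulr0 mul0r.
by rewrite !mxE !eqxx mulr1 (mulrCA (c al) delta) mulKf ?gt_eqF.
Qed.

Lemma absum_cdx i : absum (fun al => cdx i c al * monomial al h).
Proof. by rewrite cdxE; apply: absum_inj => //; exact: incr_idx_inj. Qed.

Lemma pser_is_diff : differentiable f (p + h) /\
  'd f (p + h) = (fun v : 'rV[R]_m =>
    \sum_i v 0 i * tsum (fun al => cdx i c al * monomial al h)) :> ('rV[R]_m -> R).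
Proof.
pose g i := tsum (fun al => cdx i c al * monomial al h).
have gE i : tsum (fun al => c al * mdx i al h) = g i.
  rewrite /g cdxE tsum_reindex//; first exact: incr_idx_inj.
  by move=> al /incr_idx_supp E; rewrite /mdx E !mul0r mulr0.
apply: (@quadratic_diff _ _ _ _ _ (\sum_i `|g i|)
  (delta ^- 2 * fine (asum (fun al => c al * monomial al h'))) delta) => //.
- move=> a v w; rewrite mulr_sumr -big_split /=.
  by apply: eq_bigr => i _; rewrite !mxE mulrDl mulrA.
- move=> k; apply: le_trans (ler_norm_sum _ _ _) _; rewrite mulr_suml.
  apply: ler_sum => i _; rewrite normrM mulrC ler_wpM2l//; exact: coord_norm_le.
move=> k kd.
have hk : `|h + k| < rho.
  by apply: le_lt_trans (ler_normD _ _) _; move: kd; rewrite /delta; move: hr; lra.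
rewrite -[p + h + k]addrA (fp hk).2 (fp hr).2.
have := taylor1_tsum (t01 kd) AA (fun al => T al kd) sA.
rewrite (_ : tsum (fun al => c al * \sum_i k 0 i * mdx i al h) = \sum_i k 0 i * g i); last first.
  rewrite (_ : (fun al => _) = fun al => \sum_i k 0 i * (c al * mdx i al h)).
    rewrite (tsum_sum _ (fun i => absumZ (k 0 i) (smdx i))).2.
    by apply: eq_bigr => i _; rewrite tsumZ ?gE.
  by apply/funext => al; rewrite mulr_sumr; apply: eq_bigr => i _; rewrite mulrCA.
by move=> /le_trans; apply; rewrite expr_div_n mulrAC mulrC [X in _ * X]mulrC mulrA.
Qed.

End Point.

(** The radius is kept, so differentiation can be repeated any number of times; smoothness of
    analytic functions rests on this. *)
Lemma pser_derive (f : 'rV[R]_m -> R) p c rho v : pser f p c rho ->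
  pser ('D_v f) p (fun al => \sum_i v 0 i * cdx i c al) rho.
Proof.
move=> fp h hr.
have [S1 S2] := tsum_sum (index_enum 'I_m) (fun i => absumZ (v 0 i) (absum_cdx fp hr i)).
have E : (fun al => (\sum_i v 0 i * cdx i c al) * monomial al h) =
    (fun al => \sum_i v 0 i * (cdx i c al * monomial al h)).
  by apply/funext => al; rewrite mulr_suml; apply: eq_bigr => i _; rewrite -mulrA.
have [df dE] := pser_is_diff fp hr.
rewrite E S2; split => //; rewrite deriveE// dE; apply: eq_bigr => i _.
by rewrite tsumZ//; exact: absum_cdx fp hr i.
Qed.

Lemma real_analytic_pser (U : set 'rV[R]_m) f p : real_analytic U f -> U p ->
  exists c rho, 0 < rho /\ pser f p c rho.
Proof.
move=> Uf /Uf[c [rho [rho0 H]]]; exists c, rho; split => // h hr.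
have [sh cv] := H h hr; split => //.
pose F al := c al * monomial al h.
pose toN N (g : {ffun 'I_m -> 'I_N}) : {ffun 'I_m -> nat} := [ffun i => nat_of_ord (g i)].
have itoN N : injective (@toN N).
  move=> b b' /ffunP E; apply/ffunP => i; apply: val_inj.
  by have := E i; rewrite !ffunE.
pose s N := [seq toN N g | g <- enum {ffun 'I_m -> 'I_N}].
suff cv' : (fun N => \sum_(al <- s N) F al) @ \oo --> tsum F.
  rewrite -(cvg_lim _ cv)// -(cvg_lim _ cv')//; congr lim; congr (_ @ \oo).
  by apply/funext => N; rewrite /s big_map big_enum.
apply: cvg_tsum => //.
  by move=> N; rewrite map_inj_uniq ?enum_uniq//; exact: itoN.
(* A finite set of multi-indices lies in every box whose side exceeds all their entries. *)
move=> X; exists (\max_(al <- X) \max_i al i).+1 => // N /= XN al alX.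
have lt i : (al i < N)%N.
  apply: leq_trans XN; rewrite ltnS.
  apply: leq_trans (@leq_bigmax_seq _ X predT (fun al => \max_i al i) al alX isT).
  exact: leq_bigmax.
apply/mapP; exists [ffun i => Ordinal (lt i)]; first by rewrite mem_enum.
by apply/ffunP => i; rewrite !ffunE.
Qed.

End AtPoint.
End PowerSeriesDiff.

(** * Smooth functions on open sets *)

Section DiffLemmas.
Context {R : realType}.

Lemma near_eq_diff (V W : normedModType R) (f g : V -> W) z :
  (\near z, f z = g z) -> differentiable f z ->
  differentiable g z /\ 'd g z = 'd f z :> (V -> W).
Proof.
move=> fg df; have dc := diff_continuous df.
have E : g \o shift z = cst (g z) + 'd f z +o_ 0 id.
  have Ef := diff_locally df.
  apply/eqaddoP => e e0; have /eqaddoP/(_ e e0) := Ef.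
  have := fg; rewrite (near_shift 0 z) => fg0.
  apply: filter_app; move: fg0; apply: filterS => h; rewrite /= subr0 => fgh.
  suff -> : (f \o shift z - (cst (f z) + 'd f z)) h =
    (g \o shift z - (cst (g z) + 'd f z)) h by [].
  change (f (h + z) - (f z + 'd f z h) = g (h + z) - (g z + 'd f z h)).
  by rewrite fgh (nbhs_singleton fg).
have dE : 'd g z = 'd f z :> (V -> W) by exact: diff_unique.
split; last exact: dE.
by apply/diff_locallyP; rewrite dE.
Qed.

Lemma coord_is_diff m (i : 'I_m) (p : 'rV[R]_m) :
  differentiable (fun x : 'rV[R]_m => x 0 i) p /\
  'd (fun x : 'rV[R]_m => x 0 i) p = (fun x : 'rV[R]_m => x 0 i) :> ('rV[R]_m -> R).
Proof.
apply: (@quadratic_diff _ _ _ _ _ 1 0 1) => //.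
- by move=> k u v; rewrite !mxE.
- by move=> h; rewrite mul1r coord_norm_le.
- by move=> h _; rewrite mxE (_ : _ - _ = 0) ?normr0 ?mul0r//; ring.
Qed.

Lemma diff_rV (V : normedModType R) m (f : V -> 'rV[R]_m) z :
  (forall i, differentiable (fun w => f w 0 i) z) ->
  differentiable f z /\ forall v i, ('D_v f z) 0 i = 'D_v (fun w => f w 0 i) z.
Proof.
move=> df.
have fE : f = \sum_(i < m) (fun w => f w 0 i *: (delta_mx 0 i : 'rV[R]_m)).
  apply/funext => w; rewrite fct_sumE [LHS]row_sum_delta; exact: eq_bigr.
have dfz : differentiable f z.
  by rewrite fE; apply: differentiable_sum => i; exact: differentiableZl.
split => // v i.
have -> : (fun w => f w 0 i) = (fun M : 'rV[R]_m => M 0 i) \o f by [].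
have [dc cE] := coord_is_diff i (f z).
rewrite !deriveE//; last exact: differentiable_comp.
by rewrite (diff_comp dfz dc) /= cE.
Qed.

Lemma diff_sum_delta (W : normedModType R) m (g : 'rV[R]_m -> W) p v :
  differentiable g p -> 'd g p v = \sum_i v 0 i *: 'D_(delta_mx 0 i) g p.
Proof.
move=> dg; rewrite {1}[v]row_sum_delta linear_sum; apply: eq_bigr => i _.
by rewrite linearZ deriveE.
Qed.

Lemma derive_comp_rV (V : normedModType R) m (g : 'rV[R]_m -> R) (f : V -> 'rV[R]_m) z v :
  (forall i, differentiable (fun w => f w 0 i) z) -> differentiable g (f z) ->
  differentiable (g \o f) z /\
  'D_v (g \o f) z = \sum_i 'D_v (fun w => f w 0 i) z * 'D_(delta_mx 0 i) g (f z).
Proof.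
move=> df dg; have [dfz fE] := diff_rV df.
have dgf : differentiable (g \o f) z by exact: differentiable_comp.
split => //; rewrite deriveE// diff_comp//= diff_sum_delta//.
by apply: eq_bigr => i _; rewrite -deriveE// fE.
Qed.

End DiffLemmas.

Section SmoothOn.
Context {R : realType}.

(** A version of [class_C] localised on [D]. Asking nothing at order 0 loses nothing once every
    order is required, as differentiability implies continuity. *)
Fixpoint smooth_on {V : normedModType R} (D : set V) (k : nat) (f : V -> R) : Prop :=
  if k is k'.+1 then
    (forall z, D z -> differentiable f z) /\ forall v, smooth_on D k' ('D_v f)
  else True.

Section Closure.
Context {V : normedModType R} (D : set V).
Hypothesis oD : open D.
Implicit Types (f g : V -> R) (k : nat).

Lemma smooth_onS k f : smooth_on D k.+1 f -> smooth_on D k f.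
Proof.
elim: k f => [//|k IH] f [df H]; split => // v; apply: IH; exact: H.
Qed.

Let nearD z (P : V -> Prop) : D z -> (forall w, D w -> P w) -> \near z, P z.
Proof. by move=> Dz DP; apply: filterS (open_nbhs_nbhs (conj oD Dz)); exact: DP. Qed.

Lemma smooth_on_ext k f g : (forall z, D z -> f z = g z) ->
  smooth_on D k f -> smooth_on D k g.
Proof.
elim: k f g => [//|k IH] f g fg [df H]; split => [z Dz|v].
  by have [] := near_eq_diff (nearD Dz fg) (df z Dz).
by apply: IH (H v) => z Dz; apply: near_eq_derive; exact: nearD.
Qed.

Lemma smooth_on_cst k (a : R) : smooth_on D k (fun=> a).
Proof.
elim: k a => [//|k IH] a; split => [z _|v]; first exact: differentiable_cst.
by apply: smooth_on_ext (IH 0) => z _; rewrite derive_cst.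
Qed.

Lemma smooth_onD k f g : smooth_on D k f -> smooth_on D k g ->
  smooth_on D k (fun z => f z + g z).
Proof.
elim: k f g => [//|k IH] f g [df Hf] [dg Hg]; split => [z Dz|v].
  by apply: differentiableD; [exact: df|exact: dg].
apply: smooth_on_ext (IH _ _ (Hf v) (Hg v)) => z Dz.
by rewrite [RHS](deriveD (diff_derivable (df z Dz)) (diff_derivable (dg z Dz))).
Qed.

Lemma smooth_onM k f g : smooth_on D k f -> smooth_on D k g ->
  smooth_on D k (fun z => f z * g z).
Proof.
elim: k f g => [//|k IH] f g sf sg.
have [df Hf] := sf; have [dg Hg] := sg; split => [z Dz|v].
  by apply: differentiableM; [exact: df|exact: dg].
have H1 := IH _ _ (smooth_onS sf) (Hg v); have H2 := IH _ _ (smooth_onS sg) (Hf v).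
apply: smooth_on_ext (smooth_onD H1 H2) => z Dz.
by rewrite [RHS](deriveM (diff_derivable (df z Dz)) (diff_derivable (dg z Dz))).
Qed.

Lemma smooth_on_sum k (A : Type) (l : seq A) (F : A -> V -> R) :
  (forall j, smooth_on D k (F j)) -> smooth_on D k (fun z => \sum_(j <- l) F j z).
Proof.
move=> HF; elim: l => [|j l IH].
  by apply: smooth_on_ext (smooth_on_cst k 0) => z _; rewrite big_nil.
by apply: smooth_on_ext (smooth_onD (HF j) IH) => z _; rewrite big_cons.
Qed.

Lemma smooth_on_comp m (D' : set 'rV[R]_m) k (g : 'rV[R]_m -> R) (f : V -> 'rV[R]_m) :
  (forall z, D z -> D' (f z)) -> smooth_on D' k g ->
  (forall i, smooth_on D k (fun z => f z 0 i)) -> smooth_on D k (g \o f).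
Proof.
move=> DD'; elim: k g => [//|k IH] g [dg Hg] sf.
have df z i : D z -> differentiable (fun z => f z 0 i) z.
  by move=> Dz; have [/(_ z Dz)] := sf i.
split => [z Dz|v].
  by have [] := derive_comp_rV 0 (fun i => df z i Dz) (dg _ (DD' z Dz)).
apply: (@smooth_on_ext _ (fun z =>
    \sum_i 'D_v (fun w => f w 0 i) z * 'D_(delta_mx 0 i) g (f z))).
  by move=> z Dz; have [_ ->] := derive_comp_rV v (fun i => df z i Dz) (dg _ (DD' z Dz)).
apply: smooth_on_sum => i; apply: smooth_onM; first by have [_ H] := sf i; exact: H.
exact: (IH ('D_(delta_mx 0 i) g) (Hg _) (fun j => smooth_onS (sf j))).
Qed.

End Closure.

Lemma class_C_smooth_on (V : normedModType R) (D : set V) (f : V -> R) k :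
  class_C k f -> smooth_on D k f.
Proof.
elim: k f => [//|k IH] f [df Hf]; split => [z _|v]; first exact: df.
by apply: IH; exact: Hf.
Qed.

Lemma pser_smooth_on m (U : set 'rV[R]_m) (f : 'rV[R]_m -> R) k :
  (forall p, U p -> exists c rho, 0 < rho /\ pser f p c rho) -> smooth_on U k f.
Proof.
elim: k f => [//|k IH] f Uf; split => [p /Uf[c [rho [rho0 fp]]]|v].
  have [|+ _] := pser_is_diff (h := 0) fp; first by rewrite normr0.
  by rewrite addr0.
apply: IH => p /Uf[c [rho [rho0 fp]]].
by exists (fun al => \sum_i v 0 i * cdx i c al), rho; split => //; exact: pser_derive.
Qed.

Lemma ev_smooth_on (rho sigma : R) (u : nat * nat -> R) (D : set (R * R)) k : open D ->
  (forall z, D z -> `|z.1| < rho /\ `|z.2| < sigma) ->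
  ev_absum rho sigma u -> smooth_on D k (fun z => ev u z.1 z.2).
Proof.
move=> oD DB; elim: k u => [//|k IH] u su; split => [[x y] /DB[/= xr ys]|v].
  by have [] := ev_is_diff su xr ys.
apply: (@smooth_on_ext _ _ oD _
  (fun z => v.1 * ev (aDx u) z.1 z.2 + v.2 * ev (aDy u) z.1 z.2)).
  move=> [x y] /DB[/= xr ys]; have [du dE] := ev_is_diff su xr ys.
  by rewrite deriveE// dE.
apply: smooth_onD => //; apply: smooth_onM => //; try exact: smooth_on_cst.
- by apply: IH; exact: ev_absum_aDx.
- by apply: IH; exact: ev_absum_aDy.
Qed.

End SmoothOn.

(** * Analytic ordinary differential equations *)

Section Ode.
Context {R : realType}.

Lemma derive_line (V W : normedModType R) (f : V -> W) (a v : V) (t : R) :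
  'D_1 (fun s : R => f (a + s *: v)) t = 'D_v f (a + t *: v) /\
  (derivable f (a + t *: v) v -> derivable (fun s : R => f (a + s *: v)) t 1).
Proof.
have E : (fun h : R => h^-1 *: (((fun s : R => f (a + s *: v)) \o shift t) (h *: (1 : R)) -
      f (a + t *: v))) =
    (fun h : R => h^-1 *: ((f \o shift (a + t *: v)) (h *: v) - f (a + t *: v))).
  apply/funext => h; congr (_ *: (f _ - _)).
  by rewrite /= -[h *: 1]/(h * 1) mulr1 scalerDl addrCA.
by rewrite /derive /derivable E.
Qed.

Lemma liftable_family (J I : finType) m (f : J -> 'rV[R]_m -> R) (p : 'rV[R]_m)
    (e : 'I_m -> I) :
  (forall j, exists c rho, 0 < rho /\ pser (f j) p c rho) ->
  exists eps, 0 < eps /\ forall j, liftable eps (fun a => f j (p + \row_i a (e i))).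
Proof.
move=> H; have /choice[c {}H] := H; have /choice[rho {}H] := H.
(* Halving the smallest radius gives the strict inequality [eps < rho] for the whole family. *)
pose eps := (\big[Num.min/1]_j rho j) / 2.
have m0 : 0 < \big[Num.min/1]_j rho j.
  by apply: lt_bigmin => // j _; case: (H j).
exists eps; split; first by rewrite divr_gt0.
move=> j; have [rho0 fp] := H j; apply: liftable_pser fp _.
rewrite divr_ge0 ?ltW//=; apply: (@lt_le_trans _ _ (\big[Num.min/1]_j rho j)).
  by rewrite /eps; lra.
exact: bigmin_le_cond.
Qed.

Definition psum (a : nat -> R) (t : R) : R := tsum (fun k => a k * t ^+ k).

Lemma ev_col0 (u : nat * nat -> R) t : ev u 0 t = psum (fun k => u (0, k)%N) t.
Proof.
rewrite /ev /psum -(@tsum_reindex _ _ _ _ (fun k : nat => (0, k)%N)).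
- by congr tsum; apply/funext => k; rewrite /chr /= expr0 mul1r.
- by move=> k k' [].
- by move=> [[|i] j] H; [have := H j|rewrite /chr /= exprS !mul0r mulr0].
Qed.

Lemma ev_row0 (u : nat * nat -> R) t : ev u t 0 = psum (fun k => u (k, 0)%N) t.
Proof.
rewrite /ev /psum -(@tsum_reindex _ _ _ _ (fun k : nat => (k, 0)%N)).
- by congr tsum; apply/funext => k; rewrite /chr /= expr0 mulr1.
- by move=> k k' [].
- by move=> [i [|j]] H; [have := H i|rewrite /chr /= exprS mul0r !mulr0].
Qed.

Lemma psum0 (a : nat -> R) : psum a 0 = a 0%N.
Proof.
rewrite /psum (tsum_seq (s := [:: 0%N]))//; first by rewrite big_seq1 expr0 mulr1.
by move=> [|k]; rewrite inE// => _; rewrite exprS mul0r mulr0.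
Qed.

(** The case of [cauchy_kowalevski] with zero coefficients on the x-derivatives and zero data, with
    y as time and the solution read off on the line x = 0. *)
Theorem analytic_ode (I : finType) (B : I -> (I -> R) -> R) (eps : R) :
  0 < eps -> (forall i, liftable eps (B i)) ->
  exists (a : I -> nat -> R) (rho : R),
   [/\ 0 < rho, forall i, a i 0%N = 0, forall i, absum (fun k => a i k * rho ^+ k) &
     forall i t, `|t| < rho ->
       derivable (psum (a i)) t 1 /\
       'D_1 (psum (a i)) t = B i (fun j => psum (a j) t)].
Proof.
move=> eps0 lB.
have z1 : absum (fun k => (0 : R) * 1 ^+ k).
  by rewrite (_ : (fun k => _) = fun=> 0); [exact: absum0|apply/funext => k; rewrite mul0r].
have [r [s [u [r0 s0 nu u0 uE]]]] := cauchy_kowalevski eps0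
  (fun _ _ => liftable_const eps 0) lB ltr01 (fun=> z1) (fun=> erefl).
have r20 : `|0 : R| <= r / 2 by rewrite normr0 divr_ge0// ltW.
have su i : ev_absum (r / 2) (s / 2) (u i).
  exact: ev_absum_anorm (nu i).
exists (fun i k => u i (0, k)%N), (s / 2); split.
- by rewrite divr_gt0.
- by move=> i; exact: u0.
- move=> i; have ss : `|s / 2| <= s / 2 by rewrite ger0_norm// divr_ge0// ltW.
  have := absum_ev (ltW r0) (ltW s0) r20 ss (anorm_absum (nu i)).
  move=> /(@absum_inj _ _ _ _ (fun k : nat => (0, k)%N)) H.
  have := H (fun k k' => _); move=> /(_ ltac:(by move=> k k' [])).
  by apply: le_absum => k; rewrite /chr /= expr0 mul1r.
move=> i t ts; have r2 : `|0 : R| < r / 2 by rewrite normr0 divr_gt0.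
have [du dE] := ev_is_diff (su i) r2 ts.
have [L1 L2] := derive_line (fun z : R * R => ev (u i) z.1 z.2) (0, 0) (0, 1) t.
have lE (x : R) : (0, 0) + x *: (0, 1) = (0, x) :> R * R.
  by congr (_, _) => /=; rewrite add0r ?scaler0// -[_ *: _]/(x * 1) mulr1.
have fE : (fun x : R => ev (u i) ((0, 0) + x *: (0, 1) : R * R).1
    ((0, 0) + x *: (0, 1) : R * R).2) = psum (fun k => u i (0, k)%N).
  by apply/funext => x; rewrite lE ev_col0.
rewrite /= fE lE in L1 L2; split; first by apply: L2; exact: diff_derivable.
rewrite L1 deriveE// dE /= mul0r add0r mul1r uE//.
rewrite big1 ?add0r => [|l _]; last by rewrite mulr0.
by congr (B i); apply/funext => j; rewrite ev_col0.
Qed.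

End Ode.

(** * Holomorphic discs with prescribed values on a line *)

Section SmoothFields.
Context {R : realType}.

Lemma smooth_on_coord m (U : set 'rV[R]_m) k i : open U ->
  smooth_on U k (fun z => z 0 i).
Proof.
move=> oU; case: k => [//|k]; split => [z _|v]; first by case: (coord_is_diff i z).
apply: (@smooth_on_ext _ _ _ oU _ (fun=> v 0 i)); last exact: smooth_on_cst.
by move=> z _; have [dc cE] := coord_is_diff i z; rewrite deriveE// cE.
Qed.

Definition smooth_field {V : normedModType R} {m : nat} (D : set V)
    (F : V -> 'rV[R]_m) : Prop := forall k i, smooth_on D k (fun z => F z 0 i).

Section Fields.
Context {V : normedModType R} {m : nat} (D : set V).
Hypothesis oD : open D.
Implicit Types F : V -> 'rV[R]_m.

Lemma smooth_field_diff F z : smooth_field D F -> D z -> differentiable F z.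
Proof.
move=> sF Dz; have [] // := @diff_rV _ _ _ F z.
by move=> i; have [df _] := sF 1%N i; exact: df.
Qed.

Lemma smooth_field_derive F z v i : smooth_field D F -> D z ->
  ('D_v F z) 0 i = 'D_v (fun w => F w 0 i) z.
Proof.
move=> sF Dz; have [|_ ->//] := @diff_rV _ _ _ F z.
by move=> j; have [df _] := sF 1%N j; exact: df.
Qed.

Lemma smooth_fieldD F F' : smooth_field D F -> smooth_field D F' ->
  smooth_field D (fun z => F z + F' z).
Proof.
move=> sF sF' k i; apply: smooth_on_ext (smooth_onD oD (sF k i) (sF' k i)) => // z _.
by rewrite mxE.
Qed.

End Fields.

Context {n : nat}.
Let E := 'rV[R]_(n + n).
Variable G : @christoffel R n.

Lemma smooth_field_christoffel (V : normedModType R) (D : set V) (D' : set E)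
    (f F F' : V -> E) : open D -> (forall z, D z -> D' (f z)) ->
  (forall k i j l, smooth_on D' l (G k i j)) ->
  smooth_field D f -> smooth_field D F -> smooth_field D F' ->
  smooth_field D (fun z => christoffel_form G (f z) (F z) (F' z)).
Proof.
move=> oD DD' sG sf sF sF' k l.
apply: (@smooth_on_ext _ _ _ oD _ (fun z =>
    \sum_i \sum_j G l i j (f z) * F z 0 i * F' z 0 j)).
  by move=> z _; rewrite mxE.
apply: smooth_on_sum => // i; apply: smooth_on_sum => // j.
apply: smooth_onM => //.
apply: smooth_onM => //.
by apply: (smooth_on_comp oD DD' (sG l i j k)) => i'; exact: sf.
Qed.

Lemma smooth_field_nabla (U : set E) (X Y : E -> E) : open U ->
  (forall k i j l, smooth_on U l (G k i j)) ->
  smooth_field U X -> smooth_field U Y -> smooth_field U (nabla G X Y).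
Proof.
move=> oU sG sX sY; apply: smooth_fieldD => //; last first.
  apply: (smooth_field_christoffel (D' := U)) => // k i; exact: smooth_on_coord.
move=> k i; apply: (@smooth_on_ext _ _ _ oU _ (fun z =>
    \sum_j X z 0 j * 'D_(delta_mx 0 j) (fun w => Y w 0 i) z)).
  move=> z Uz; rewrite (smooth_field_derive _ _ sY Uz) deriveE.
    by rewrite diff_sum_delta//; have [df _] := sY 1%N i; exact: df.
  by have [df _] := sY 1%N i; exact: df.
apply: smooth_on_sum => // j; apply: smooth_onM => //.
by have [_ H] := sY k.+1 i; exact: H.
Qed.

Lemma smooth_field_iter_nabla (U : set E) (X Y : E -> E) k : open U ->
  (forall k i j l, smooth_on U l (G k i j)) ->
  smooth_field U X -> smooth_field U Y -> smooth_field U (iter_nabla G k X Y).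
Proof.
by move=> oU sG sX sY; elim: k => [//|k IH]; exact: smooth_field_nabla.
Qed.

Section AlongDisc.
Variables (D : set (R * R)) (gamma : R * R -> E).
Hypothesis oD : open D.
Hypothesis sgamma : smooth_field D gamma.

Lemma smooth_field_partial_x (W : R * R -> E) : smooth_field D W ->
  smooth_field D (partial_x W).
Proof.
move=> sW k i; have [_ H] := sW k.+1 i.
apply: smooth_on_ext (H (1, 0)) => // z Dz.
by rewrite /partial_x (smooth_field_derive _ _ sW Dz).
Qed.

Lemma smooth_field_cov_x (W : R * R -> E) :
  (forall k i j l, smooth_on setT l (G k i j)) -> smooth_field D W ->
  smooth_field D (cov_x G gamma W).
Proof.
move=> sG sW; apply: smooth_fieldD => //; first exact: smooth_field_partial_x.
by apply: (smooth_field_christoffel (D' := setT)) => //; exact: smooth_field_partial_x.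
Qed.

Lemma smooth_field_xder k : smooth_field D (xder k gamma).
Proof. by elim: k => [//|k IH]; exact: smooth_field_partial_x. Qed.

Lemma smooth_field_cov_xder k : (forall k i j l, smooth_on setT l (G k i j)) ->
  smooth_field D (cov_xder G k gamma).
Proof.
move=> sG; rewrite /cov_xder; elim: k.-1 => [|m IH]; first exact: smooth_field_partial_x.
exact: smooth_field_cov_x.
Qed.

End AlongDisc.

End SmoothFields.

(** * Construction of the disc from its values on the real axis *)

Section Disc.
Context {R : realType} {n : nat}.
Let E := 'rV[R]_(n + n).

Definition square (eps : R) : set (R * R) := [set z | `|z.1| < eps /\ `|z.2| < eps].

Lemma square_open eps : open (square eps).
Proof.
have -> : square eps = ball (0 : R * R) eps.
  rewrite -ball_normE; apply/seteqP; split => -[x y];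
    by rewrite /square /ball_ /= sub0r normrN prod_normE gt_max => /andP.
exact: ball_open.
Qed.

Lemma disc_square (eps : R) z : 0 < eps -> disc eps z -> square eps z.
Proof.
move=> e0; rewrite /disc /square /= => H.
by split; rewrite -(ltr_pXn2r (n := 2))// ?nnegrE ?(ltW e0)// real_normK ?num_real//;
  apply: le_lt_trans H; rewrite ?lerDl ?lerDr sqr_ge0.
Qed.

Lemma holomorphic_disc (J : E -> 'M[R]_(n + n)) (p : E) (a : 'I_(n + n) -> nat -> R)
    (rho : R) :
  almost_complex J -> real_analytic_structure J -> 0 < rho ->
  (forall i, a i 0%N = 0) -> (forall i, absum (fun k => a i k * rho ^+ k)) ->
  exists (gamma : R * R -> E) (eps : R),
    [/\ 0 < eps, smooth_field (square eps) gamma, J_holomorphic J eps gamma &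
        forall x, gamma (x, 0) = p + \row_i psum (a i) x].
Proof.
move=> JJ aJ rho0 a0 sa.
have [e [e0 lJ]] : exists e, 0 < e /\ forall q : 'I_(n + n) * 'I_(n + n),
    liftable e (fun a => J (p + \row_i a i) q.1 q.2).
  apply: (@liftable_family _ _ _ _ (fun q z => J z q.1 q.2) p id) => q.
  exact: real_analytic_pser (aJ q.1 q.2) I.
have [r [s [u [r0 s0 nu u0 uE]]]] := cauchy_kowalevski e0
  (fun l k => lJ (l, k)) (fun k : 'I_(n + n) => liftable_const e 0) rho0 sa a0.
pose eps := Num.min (r / 2) (s / 2).
have eps0 : 0 < eps by rewrite lt_min !divr_gt0.
have er z : square eps z -> `|z.1| < r / 2 /\ `|z.2| < s / 2.
  by rewrite /square /= /eps !lt_min => -[/andP[-> _] /andP[_ ->]].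
have su i : ev_absum (r / 2) (s / 2) (u i).
  exact: ev_absum_anorm (nu i).
pose gamma (z : R * R) : E := p + \row_i ev (u i) z.1 z.2.
have oS : open (square eps) by exact: square_open.
have sgamma : smooth_field (square eps) gamma.
  move=> k i; apply: (@smooth_on_ext _ _ _ oS _ (fun z => p 0 i + ev (u i) z.1 z.2)).
    by move=> z _; rewrite !mxE.
  apply: smooth_onD => //; first exact: smooth_on_cst.
  exact: ev_smooth_on (su i).
pose gx (z : R * R) : E := \row_i ev (aDx (u i)) z.1 z.2.
pose gy (z : R * R) : E := \row_i ev (aDy (u i)) z.1 z.2.
have gyE z : square eps z -> gy z = gx z *m J (gamma z).
  move=> /er[z1 z2]; apply/rowP => k; rewrite !mxE uE// addr0.
  by apply: eq_bigr => l _; rewrite !mxE.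
have dgamma z v : square eps z -> 'd gamma z v = v.1 *: gx z + v.2 *: gy z.
  move=> sz; rewrite -deriveE; last exact: smooth_field_diff sgamma sz.
  apply/rowP => i; rewrite (smooth_field_derive _ _ sgamma sz) !mxE.
  have [z1 z2] := er z sz; have [du dE] := ev_is_diff (su i) z1 z2.
  rewrite -surjective_pairing in du dE.
  rewrite (_ : (fun w => gamma w 0 i) = (fun w => p 0 i + ev (u i) w.1 w.2)); last first.
    by apply/funext => w; rewrite !mxE.
  rewrite (deriveD (f := cst (p 0 i))); [|exact: derivable_cst|exact: diff_derivable].
  by rewrite derive_cst add0r deriveE// dE.
have sg : smooth_field (square eps) gx /\ smooth_field (square eps) gy.
  split=> k i.
    apply: (@smooth_on_ext _ _ _ oS _ (fun z => ev (aDx (u i)) z.1 z.2)).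
      by move=> z _; rewrite mxE.
    by apply: ev_smooth_on er _ => //; exact: ev_absum_aDx.
  apply: (@smooth_on_ext _ _ _ oS _ (fun z => ev (aDy (u i)) z.1 z.2)).
    by move=> z _; rewrite mxE.
  by apply: ev_smooth_on er _ => //; exact: ev_absum_aDy.
exists gamma, eps; split; [exact: eps0|exact: sgamma| |]; last first.
  (* This holds for every x: both sides are sums of the same family up to zero terms, convergent or
     not. *)
  move=> x; apply: (congr1 (fun v => p + v)); apply/rowP => i; rewrite !mxE ev_row0.
  by congr (psum _ x); apply/funext => k; exact: u0.
move=> z /(disc_square eps0) sz; split.
- exact: smooth_field_diff sgamma sz.
- move=> v.
  have cv : {for z, continuous (fun w => v.1 *: gx w + v.2 *: gy w)}.
    apply: cvgD; apply: cvgZr; apply: differentiable_continuous.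
      exact: smooth_field_diff sg.1 sz.
    exact: smooth_field_diff sg.2 sz.
  have nE : \forall w \near z, v.1 *: gx w + v.2 *: gy w = 'd gamma w v.
    by apply: filterS (open_nbhs_nbhs (conj oS sz)) => w sw; rewrite dgamma.
  have := cvg_trans (near_eq_cvg nE) cv; rewrite -(dgamma z v sz); exact.
(* The equation solved is the Cauchy-Riemann condition in the direction (1, 0) only; J^2 = -1 yields
   the direction (0, 1). *)
- move=> v; rewrite !dgamma//= gyE// mulmxDl -!scalemxAl -mulmxA JJ mulmxN mulmx1.
  by rewrite scalerN scaleNr addrC.
Qed.

End Disc.

(** * Development of a curve *)

Section Development.
Context {R : realType} {n : nat}.
Let N := (n + n)%N.
Let E := 'rV[R]_N.
Implicit Types (G : @christoffel R n) (X Y : E -> E).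

Definition connection_mx G X (z : E) : 'M[R]_N :=
  \matrix_(j, k) \sum_i G k i j z * X z 0 i.

Lemma christoffel_form_mx G X z (v : E) :
  christoffel_form G z (X z) v = v *m connection_mx G X z.
Proof.
apply/rowP => k; rewrite !mxE exchange_big /=; apply: eq_bigr => j _.
by rewrite !mxE mulr_sumr; apply: eq_bigr => i _; rewrite mulrC.
Qed.

Lemma development G X (p : E) :
  (forall i, exists c rho, 0 < rho /\ pser (fun z => X z 0 i) p c rho) ->
  (forall k i j, exists c rho, 0 < rho /\ pser (G k i j) p c rho) ->
  exists (a d : 'I_N -> nat -> R) (P : R -> 'M[R]_N) (rho : R),
  let c t := p + \row_i psum (a i) t in
  [/\ 0 < rho /\ P 0 = 1%:M,
      forall i, a i 0%N = 0 /\ d i 0%N = 0,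
      forall i, absum (fun k => a i k * rho ^+ k) /\ absum (fun k => d i k * rho ^+ k),
      forall t i, `|t| < rho ->
        [/\ derivable (psum (a i)) t 1, 'D_1 (psum (a i)) t = X (c t) 0 i,
            derivable (psum (d i)) t 1 & 'D_1 (psum (d i)) t = (X (c t) *m P t) 0 i] &
      forall t i j, `|t| < rho ->
        derivable (fun s => P s i j) t 1 /\
        'D_1 (fun s => P s i j) t = (connection_mx G X (c t) *m P t) i j].
Proof.
move=> aX aG.
(* The unknowns are the displacement c - p, the entries of P - 1, and the displacement of the
   development. All vanish at time 0, as [analytic_ode] provides. *)
pose I := (('I_N + 'I_N * 'I_N) + 'I_N)%type.
pose z (a : I -> R) : E := p + \row_i a (inl (inl i)).
pose Q (a : I -> R) j l : R := (j == l)%:R + a (inl (inr (j, l))).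
pose B (x : I) (a : I -> R) : R := match x with
  | inl (inl k) => X (z a) 0 k
  | inl (inr (j, l)) => \sum_k (\sum_i G k i j (z a) * X (z a) 0 i) * Q a k l
  | inr l => \sum_j X (z a) 0 j * Q a j l
  end.
have [e1 [e10 lX]] := liftable_family (fun i : 'I_N => inl (inl i) : I) aX.
have [e2 [e20 lG]] := @liftable_family R ('I_N * 'I_N * 'I_N)%type I N
  (fun q => G q.1.1 q.1.2 q.2) p (fun i : 'I_N => inl (inl i) : I)
  (fun q => aG q.1.1 q.1.2 q.2).
pose e := Num.min e1 e2.
have e0 : 0 < e by rewrite lt_min e10.
have {}lX i : liftable e (fun a => X (z a) 0 i).
  by apply: liftable_le (lX i); rewrite ge_min lexx.
have {}lG k i j : liftable e (fun a => G k i j (z a)).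
  by apply: liftable_le (lG (k, i, j)); rewrite ge_min lexx orbT.
have lQ j l : liftable e (fun a => Q a j l).
  by apply: liftableD; [exact: liftable_const|exact: liftable_var].
have lB x : liftable e (B x).
  case: x => [[k|[j l]]|l]; first exact: lX.
    apply: liftable_sum => k; apply: liftableM; last exact: lQ.
    by apply: liftable_sum => i; apply: liftableM; [exact: lG|exact: lX].
  by apply: liftable_sum => j; apply: liftableM; [exact: lX|exact: lQ].
have [a [rho [rho0 a0 sa aE]]] := analytic_ode e0 lB.
exists (fun i => a (inl (inl i))), (fun i => a (inr i)),
  (fun t => \matrix_(j, l) ((j == l)%:R + psum (a (inl (inr (j, l)))) t)), rho.
move=> c; split => //.
- by split => //; apply/matrixP => j l; rewrite !mxE psum0 a0 addr0.
- move=> t i tr; have [d1 D1] := aE (inl (inl i)) t tr; have [d2 D2] := aE (inr i) t tr.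
  split; [exact: d1|exact: D1|exact: d2|].
  by rewrite D2 /= mxE; apply: eq_bigr => j _; rewrite [in RHS]mxE.
- move=> t i j tr; have [d1 D1] := aE (inl (inr (i, j))) t tr.
  rewrite (_ : (fun s => _) = (cst (i == j)%:R + psum (a (inl (inr (i, j)))))); last first.
    by apply/funext => s; rewrite mxE.
  have dcst : derivable (cst ((i == j)%:R : R)) t 1 by exact: derivable_cst.
  split; first exact: (derivableD dcst d1).
  rewrite (deriveD dcst d1) derive_cst add0r D1 /= mxE; apply: eq_bigr => k _.
  by rewrite !mxE.
Qed.

Lemma partial_xE (W : R * R -> E) x : partial_x W (x, 0) = 'D_1 (fun s => W (s, 0)) x.
Proof.
have [+ _] := derive_line W (0, 0) (1, 0) x.
have lE (s : R) : (0, 0) + s *: (1, 0) = (s, 0) :> R * R.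
  by congr (_, _) => /=; rewrite add0r ?scaler0// -[_ *: _]/(s * 1) mulr1.
rewrite /partial_x lE => <-; congr ('D_1 _ x); apply/funext => s; by rewrite lE.
Qed.

Lemma derive_sumM (m : nat) (f g : 'I_m -> R -> R) (t : R) :
  (forall j, derivable (f j) t 1) -> (forall j, derivable (g j) t 1) ->
  derivable (fun s => \sum_j f j s * g j s) t 1 /\
  'D_1 (fun s => \sum_j f j s * g j s) t =
  \sum_j ('D_1 (f j) t * g j t + f j t * 'D_1 (g j) t).
Proof.
move=> df dg.
have -> : (fun s => \sum_j f j s * g j s) = \sum_j (f j * g j).
  by apply/funext => s; rewrite fct_sumE.
have dfg j : derivable (f j * g j) t 1 by exact: derivableM.
split; first exact: derivable_sum.
rewrite derive_sum//; apply: eq_bigr => j _.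
rewrite (deriveM (df j) (dg j)) addrC; congr (_ + _); exact: mulrC.
Qed.

Section AlongCurve.
Variables (G : @christoffel R n) (X : E -> E) (U : set E) (c : R -> E) (eta : R).
Hypothesis oU : open U.
Hypothesis sX : smooth_field U X.
Hypothesis sG : forall k i j l, smooth_on U l (G k i j).
Hypothesis Uc : forall t, `|t| < eta -> U (c t).
Hypothesis dc : forall t i, `|t| < eta ->
  derivable (fun s => c s 0 i) t 1 /\ 'D_1 (fun s => c s 0 i) t = X (c t) 0 i.

Let near_eta (t : R) : `|t| < eta -> \forall s \near t, `|s : R| < eta.
Proof.
have bE s : ball (0 : R) eta s <-> `|s| < eta by rewrite -ball_normE /ball_ /= sub0r normrN.
move=> /bE te; apply: filterS (open_nbhs_nbhs (conj (@ball_open _ _ 0 eta) te)) => s.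
by move/bE.
Qed.

Lemma derive_along_curve (Y : E -> E) t i : smooth_field U Y -> `|t| < eta ->
  derivable (fun s => Y (c s) 0 i) t 1 /\
  'D_1 (fun s => Y (c s) 0 i) t = ('D_(X (c t)) Y (c t)) 0 i.
Proof.
move=> sY te; have [dY _] := sY 1%N i.
have dci j : differentiable (fun s => c s 0 j) t by apply/derivable1_diffP; case: (dc j te).
have [d1 D1] := derive_comp_rV (1 : R) dci (dY _ (Uc te)).
split; first exact: diff_derivable.
rewrite [LHS]D1 (smooth_field_derive _ _ sY (Uc te)) deriveE; last exact: dY (Uc te).
rewrite diff_sum_delta; last exact: dY (Uc te).
by apply: eq_bigr => j _; have [_ ->] := dc j te.
Qed.

Variable gamma : R * R -> E.

(** Along an integral curve of [X] the covariant derivative of [Y] restricted to the curve is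
    [nabla G X Y] there. The identity is proved on an interval, since the induction differentiates
    it. *)
Lemma cov_xder_along_curve : (forall x, `|x| < eta -> gamma (x, 0) = c x) ->
  forall m x, `|x| < eta ->
  iter m (cov_x G gamma) (partial_x gamma) (x, 0) = iter_nabla G m X X (c x).
Proof.
move=> gc.
have gx x : `|x| < eta -> partial_x gamma (x, 0) = X (c x).
  move=> xe; rewrite partial_xE (near_eq_derive (g := c)); last first.
    by near=> s; apply: gc; near: s; exact: near_eta.
  apply/rowP => i; have [j|_ ->] := @diff_rV _ _ _ c x.
    by apply/derivable1_diffP; case: (dc j xe).
  by case: (dc i xe).
elim=> [//|m IH] x xe; rewrite /iter_nabla !iterS -/(iter_nabla _ _ _ _).
rewrite /cov_x /nabla (gc x xe) (gx x xe) (IH x xe).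
apply: (congr1 (fun v => v + christoffel_form G (c x) (X (c x)) (iter_nabla G m X X (c x)))).
rewrite partial_xE (near_eq_derive (g := fun s => iter_nabla G m X X (c s))); last first.
  by near=> s; apply: IH; near: s; exact: near_eta.
have sY : smooth_field U (iter_nabla G m X X) by exact: smooth_field_iter_nabla.
apply/rowP => i; have [j|_ ->] := @diff_rV _ _ _ (fun s => iter_nabla G m X X (c s)) x.
  by apply/derivable1_diffP; case: (derive_along_curve j sY xe).
by case: (derive_along_curve i sY xe).
Unshelve. all: by end_near. Qed.

(** With w the connection matrix along the curve, P' = w P gives (Y P)' = (Y' + Y w) P = (nabla_X Y)
    P: multiplication by [P] turns covariant derivatives into ordinary ones. *)
Lemma xder_along_curve (P : R -> 'M[R]_N) :
  (forall t i, `|t| < eta -> derivable (fun s => gamma (s, 0) 0 i) t 1 /\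
     'D_1 (fun s => gamma (s, 0) 0 i) t = (X (c t) *m P t) 0 i) ->
  (forall t i j, `|t| < eta -> derivable (fun s => P s i j) t 1 /\
     'D_1 (fun s => P s i j) t = (connection_mx G X (c t) *m P t) i j) ->
  forall m x, `|x| < eta ->
  xder m.+1 gamma (x, 0) = iter_nabla G m X X (c x) *m P x.
Proof.
move=> dg dP; elim=> [|m IH] x xe.
  rewrite /xder /= partial_xE.
  apply/rowP => i; have [j|_ ->] := @diff_rV _ _ _ (fun s => gamma (s, 0)) x.
    by apply/derivable1_diffP; case: (dg x j xe).
  by case: (dg x i xe).
rewrite /xder iterS -/(xder _ _) partial_xE.
rewrite (near_eq_derive (g := fun s => iter_nabla G m X X (c s) *m P s)); last first.
  by near=> s; apply: IH; near: s; exact: near_eta.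
have sY : smooth_field U (iter_nabla G m X X) by exact: smooth_field_iter_nabla.
set Y := iter_nabla G m X X.
have H k : derivable (fun s => (Y (c s) *m P s) 0 k) x 1 /\
   'D_1 (fun s => (Y (c s) *m P s) 0 k) x = (iter_nabla G m.+1 X X (c x) *m P x) 0 k.
  have [d1 D1] := derive_sumM (fun j => (derive_along_curve j sY xe).1)
    (fun j => (dP x j k xe).1).
  rewrite (_ : (fun s => _) = (fun s => \sum_j Y (c s) 0 j * P s j k)); last first.
    by apply/funext => s; rewrite mxE.
  split; first exact: d1.
  rewrite [LHS]D1 /iter_nabla iterS -/(iter_nabla _ _ _ _) -/Y /nabla christoffel_form_mx.
  rewrite mulmxDl -mulmxA [RHS]mxE [X in _ = X + _]mxE [X in _ = _ + X]mxE -big_split /=.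
  by apply: eq_bigr => j _; rewrite (derive_along_curve j sY xe).2 (dP x j k xe).2.
apply/rowP => k; have [j|_ ->] := @diff_rV _ _ _ (fun s => Y (c s) *m P s) x.
  by apply/derivable1_diffP; case: (H j).
by case: (H k).
Unshelve. all: by end_near. Qed.

End AlongCurve.
End Development.

(** * The two discs through a point near the origin *)

Section Final.
Context {R : realType} {n : nat}.
Local Notation E := 'rV[R]_(n + n).

Lemma pser0 (p : E) : exists c rho, 0 < rho /\ pser (fun=> 0 : R) p c rho.
Proof.
exists (fun=> 0), 1; split => // h _.
rewrite (_ : (fun al => _) = fun=> 0); last by apply/funext => al; rewrite mul0r.
by split; [exact: absum0|rewrite tsum0].
Qed.

Lemma psum_near (U : set E) (p : E) (a : 'I_(n + n) -> nat -> R) : open U -> U p ->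
  (forall i, a i 0%N = 0) -> (forall i, derivable (psum (a i)) 0 1) ->
  exists eta, 0 < eta /\ forall t, `|t| < eta -> U (p + \row_i psum (a i) t).
Proof.
move=> oU Up a0 da.
pose c t : E := p + \row_i psum (a i) t.
have c0 : c 0 = p by apply/rowP => i; rewrite !mxE psum0 a0 addr0.
have dc : differentiable c 0.
  apply: (diff_rV _).1 => i.
  rewrite (_ : (fun w => _) = (fun w => cst (p 0 i) w + psum (a i) w)).
    by apply: differentiableD => //; apply/derivable1_diffP.
  by apply/funext => t; rewrite !mxE.
have /nbhs_ballP[e /= e0 eU] : nbhs (0 : R) (c @^-1` U).
  by apply: (differentiable_continuous dc); rewrite c0; exact: open_nbhs_nbhs.
exists e; split => // t te; apply: eU.
by rewrite -ball_normE /ball_ /= sub0r normrN.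
Qed.

End Final.

Theorem theorem1p4 (R : realType) (n : nat)
    (phi : 'rV[R]_(n + n) -> R)
    (J : 'rV[R]_(n + n) -> 'M[R]_(n + n))
    (G : @christoffel R n)
    (U : set 'rV[R]_(n + n))
    (X : 'rV[R]_(n + n) -> 'rV[R]_(n + n)) :
  real_analytic_hypersurface phi ->
  hypersurface phi 0 ->
  almost_complex J ->
  real_analytic_structure J ->
  J 0 = J0 ->
  smooth_connection G ->
  symmetric_connection G ->
  open U ->
  U 0 ->
  real_analytic_field U X ->
  in_J_tangent J phi U X ->
  (forall Y, generated_Lie J U X Y -> in_J_tangent J phi U Y) ->
  \forall p \near (0 : 'rV[R]_(n + n)), hypersurface phi p ->
    (* derivatives of the disc taken with the connection *)
    (exists (gamma : R * R -> 'rV[R]_(n + n)) (eps : R),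
       [/\ 0 < eps,
           J_holomorphic J eps gamma,
           gamma (0, 0) = p &
           forall k : nat, (1 <= k)%N ->
             x_derivable eps (cov_xder G k gamma) /\
             cov_xder G k gamma (0, 0) = iter_nabla G k.-1 X X p])
    /\
    (* derivatives of the disc taken in the coordinates of R^{2n} *)
    (real_analytic_connection G ->
     exists (gamma : R * R -> 'rV[R]_(n + n)) (eps : R),
       [/\ 0 < eps,
           J_holomorphic J eps gamma,
           gamma (0, 0) = p &
           forall k : nat, (1 <= k)%N ->
             x_derivable eps (xder k gamma) /\
             xder k gamma (0, 0) = iter_nabla G k.-1 X X p]).
Proof.
move=> _ _ JJ aJ _ sG _ oU U0 aX _ _.
have sX : smooth_field U X.
  move=> k i; apply: pser_smooth_on => p Up; exact: real_analytic_pser (aX i) Up.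
have sGD (D : set 'rV[R]_(n + n)) k i j l : smooth_on D l (G k i j).
  exact: class_C_smooth_on (sG k i j l).
near=> p => _.
have Up : U p by near: p; exact: open_nbhs_nbhs.
have aXp i := real_analytic_pser (aX i) Up.
have psum00 (a : 'I_(n + n) -> nat -> R) : (forall i, a i 0%N = 0) ->
    p + \row_i psum (a i) 0 = p.
  by move=> a0; apply/rowP => i; rewrite !mxE psum0 a0 addr0.
have coordE (a : 'I_(n + n) -> nat -> R) i :
    (fun s => (p + \row_i psum (a i) s) 0 i) = (fun s => cst (p 0 i) s + psum (a i) s).
  by apply/funext => s; rewrite !mxE.
have coord_derive (a : 'I_(n + n) -> nat -> R) i t : derivable (psum (a i)) t 1 ->
    derivable (fun s => (p + \row_i psum (a i) s) 0 i) t 1 /\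
    'D_1 (fun s => (p + \row_i psum (a i) s) 0 i) t = 'D_1 (psum (a i)) t.
  move=> da; have dcst : derivable (cst (p 0 i)) t 1 by exact: derivable_cst.
  rewrite coordE; split; first exact: (derivableD dcst da).
  by rewrite [LHS](deriveD dcst da) derive_cst add0r.
split.
  (* Here only the integral curve is wanted, so [development] is fed zero Christoffel symbols, which
     are analytic, in place of the merely smooth [G]. *)
  have [a [d [P [rho [[rho0 _] ad0 sad aE _]]]]] :=
    @development _ _ (fun _ _ _ => fun=> 0) X p aXp (fun _ _ _ => pser0 p).
  have a0 i : a i 0%N = 0 by case: (ad0 i).
  have da0 i : derivable (psum (a i)) 0 1.
    by have [|d1 _ _ _] := aE 0 i; [rewrite normr0|exact: d1].
  have [eta0 [eta00 Uc0]] := psum_near oU Up a0 da0.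
  (* Up to this time the curve stays in [U] and its series solves the equation. *)
  pose eta := Num.min eta0 rho.
  have eta_gt0 : 0 < eta by rewrite lt_min eta00.
  have [gamma [eps [eps0 sg hg gE]]] := holomorphic_disc p JJ aJ rho0 a0 (fun i => (sad i).1).
  exists gamma, eps; split; [exact: eps0|exact: hg|by rewrite gE psum00|].
  move=> [//|k] _; split.
    move=> z /(disc_square eps0) sz; apply: diff_derivable.
    have oS : open (square eps) by exact: square_open.
    exact: smooth_field_diff (smooth_field_cov_xder oS sg k.+1 (sGD setT)) sz.
  rewrite /cov_xder /= (@cov_xder_along_curve _ _ G X U
    (fun t => p + \row_i psum (a i) t) eta oU sX (sGD U)).
  - by rewrite psum00.
  - by move=> t; rewrite /eta lt_min => /andP[te _]; exact: Uc0.
  - move=> t i; rewrite /eta lt_min => /andP[_ tr].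
    have [d1 D1 _ _] := aE t i tr; have [d2 D2] := coord_derive a i t d1.
    by split; [exact: d2|rewrite D2 D1].
  - by move=> x _; exact: gE.
  - by rewrite normr0.
move=> aG.
have aGp k i j := real_analytic_pser (aG k i j) (I : setT p).
have [a [d [P [rho [[rho0 P0] ad0 sad aE PE]]]]] := development aXp aGp.
have a0 i : a i 0%N = 0 by case: (ad0 i).
have d0 i : d i 0%N = 0 by case: (ad0 i).
have da0 i : derivable (psum (a i)) 0 1.
  by have [|d1 _ _ _] := aE 0 i; [rewrite normr0|exact: d1].
have [eta0 [eta00 Uc0]] := psum_near oU Up a0 da0.
pose eta := Num.min eta0 rho.
have eta_gt0 : 0 < eta by rewrite lt_min eta00.
(* The real axis is now sent to the development [d] instead of the integral curve [a]; at the centre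
   the factor [P] is the identity and disappears from the derivatives. *)
have [gamma [eps [eps0 sg hg gE]]] := holomorphic_disc p JJ aJ rho0 d0 (fun i => (sad i).2).
exists gamma, eps; split; [exact: eps0|exact: hg|by rewrite gE psum00|].
move=> [//|k] _; split.
  move=> z /(disc_square eps0) sz; apply: diff_derivable.
  have oS : open (square eps) by exact: square_open.
  exact: smooth_field_diff (smooth_field_xder oS sg k.+1) sz.
rewrite (@xder_along_curve _ _ G X U
  (fun t => p + \row_i psum (a i) t) eta oU sX (sGD U) _ _ gamma P).
- by rewrite psum00// P0 mulmx1.
- by move=> t; rewrite /eta lt_min => /andP[te _]; exact: Uc0.
- move=> t i; rewrite /eta lt_min => /andP[_ tr].
  have [d1 D1 _ _] := aE t i tr; have [d2 D2] := coord_derive a i t d1.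
  by split; [exact: d2|rewrite D2 D1].
- move=> t i; rewrite /eta lt_min => /andP[_ tr].
  have [_ _ d1 D1] := aE t i tr; have [d2 D2] := coord_derive d i t d1.
  rewrite (_ : (fun s => gamma (s, 0) 0 i) = (fun s => (p + \row_i psum (d i) s) 0 i)).
    by split; [exact: d2|rewrite D2 D1].
  by apply/funext => s; rewrite gE.
- by move=> t i j; rewrite /eta lt_min => /andP[_ tr]; exact: PE.
- by rewrite normr0.
Unshelve. all: by end_near. Qed.
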